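(* Let $\mathbf z=(Z_1,\dots,Z_n)$ be a random vector taking values in a Polish space $\mathcal Z=\mathcal Z_1\times\dots\times\mathcal Z_n$ (a product of Polish spaces, $Z_k$ taking values in $\mathcal Z_k$) and, for each index $k$, let $Z_k'$ be a random variable such that $Z_k'$ and $Z_k$ are conditionally i.i.d. given $(Z_j)_{j\ne k}$. Suppose that $\mathbf H:\mathcal Z\to\mathbb H^d$ is a bounded measurable function that satisfies, for a parameter $s>0$, the self-reproducing property $$\sum_{k=1}^n\big(\mathbf H(\mathbf z)-\mathbb E[\mathbf H(\mathbf z)\mid(Z_j)_{j\ne k}]\big)=s\cdot\big(\mathbf H(\mathbf z)-\mathbb E\,\mathbf H(\mathbf z)\big)\qquad\text{almost surely},$$ as well as the bounded differences condition $$\mathbb E\big[\big(\mathbf H(\mathbf z)-\mathbf H(Z_1,\dots,Z_{k-1},Z_k',Z_{k+1},\dots,Z_n)\big)^2\mid\mathbf z\big]\preccurlyeq\mathbf A_k^2\qquad\text{almost surely, for each index }k,$$ where each $\mathbf A_k$ is a deterministic matrix in $\mathbb H^d$. Then, for all $t\ge0$, $$\mathbb P\{\lambda_{\max}(\mathbf H(\mathbf z)-\mathbb E\,\mathbf H(\mathbf z))\ge t\}\le d\cdot e^{-st^2/L}\qquad\text{for }\ L=\Big\|\sum_{k=1}^n\mathbf A_k^2\Big\|.$$ Furthermore, $$\mathbb E\,\lambda_{\max}(\mathbf H(\mathbf z)-\mathbb E\,\mathbf H(\mathbf z))\le\sqrt{\frac{L\log d}{s}}.$$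
   Context: $\mathbb H^d$ is the space of $d\times d$ complex Hermitian matrices; $\mathbf A\preccurlyeq\mathbf B$ means $\mathbf B-\mathbf A$ is positive semidefinite; $\lambda_{\max}$ is the largest eigenvalue; $\|\cdot\|$ is the spectral norm. *)

(* Defs.v *)
From HB Require Import structures.
From mathcomp Require Import all_boot all_order all_algebra.
From mathcomp Require Import complex.
From mathcomp Require Import all_classical all_reals all_analysis.

Set Implicit Arguments.
Unset Strict Implicit.
Unset Printing Implicit Defensive.

Import Order.TTheory GRing.Theory Num.Theory.
Import numFieldNormedType.Exports.

Local Open Scope classical_set_scope.
Local Open Scope ring_scope.
Local Open Scope sesquilinear_scope.

Section complex_matrices.
Context {R : realType}.

Definition complex_mx m n (A B : 'M[R]_(m, n)) : 'M[R[i]]_(m, n) :=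
  \matrix_(i, j) Complex (A i j) (B i j).

Definition psdmx n (A : 'M[R[i]]_n) : Prop :=
  A \is hermsymmx /\ forall u : 'cV[R[i]]_n, 0 <= (u^t* *m A *m u) 0 0.

Definition loewner_le n (A B : 'M[R[i]]_n) : Prop := psdmx (B - A).

(* Intended for Hermitian [A] of size [n > 0]: the eigenvalues are then real,
   and the supremum is over a nonempty finite set. *)
Definition lambda_max n (A : 'M[R[i]]_n) : R :=
  sup [set x : R | eigenvalue A (x%:C)%C].

Definition l2norm n (u : 'cV[R[i]]_n) : R :=
  Num.sqrt (\sum_(i < n) (complex.Re (u i 0) ^+ 2 + complex.Im (u i 0) ^+ 2)).

Definition spectral_norm n (A : 'M[R[i]]_n) : R :=
  sup [set l2norm (A *m u) | u in [set u : 'cV[R[i]]_n | l2norm u <= 1]].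

End complex_matrices.

Section borel_structures.

Definition separable (T : topologicalType) : Prop :=
  exists2 D : set T, countable D & dense D.

Definition completely_metrizable (R : realType) (T : topologicalType) : Prop :=
  exists dist : T -> T -> R,
    [/\ forall x y, 0 <= dist x y /\ (dist x y = 0 <-> x = y),
        forall x y, dist x y = dist y x,
        forall x y z, dist x z <= dist x y + dist y z,
        forall x : T, nbhs x = nbhs_ball_ (fun y e => [set z | dist y z < e]) x &
        forall u : nat -> T,
          (forall e, 0 < e -> exists N : nat, forall m n : nat,
             (N <= m)%N -> (N <= n)%N -> dist (u m) (u n) < e) ->
          exists l : T, u @ \oo --> l].

Definition polish (R : realType) (T : topologicalType) : Prop :=
  separable T /\ completely_metrizable R T.

Definition borel (T : topologicalType) : set (set T) := <<s @open T >>.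

(* Measurability relative to explicit sigma-algebras, so that sub-sigma-algebras
   of the sample space can be used and no base point is required. *)
Definition measurable_wrt (X Y : Type) (F : set (set X)) (G : set (set Y))
    (f : X -> Y) : Prop :=
  forall B, G B -> F (f @^-1` B).

Definition measurable_mx_wrt (R : realType) (X : Type) (F : set (set X)) m
    (f : X -> 'M[R[i]]_m) : Prop :=
  forall i j,
    measurable_wrt F (measurable : set (set R)) (fun x => complex.Re (f x i j)) /\
    measurable_wrt F (measurable : set (set R)) (fun x => complex.Im (f x i j)).

Definition sigma_of (W : Type) (T : topologicalType) (z : W -> T) :
    set (set W) :=
  preimage_set_system setT z (@borel T).

Definition sigma_except (W : Type) n (T : 'I_n -> topologicalType)
    (z : W -> prod_topology T) (k : 'I_n) : set (set W) :=
  <<s \bigcup_(j in [set j | j != k]) sigma_of (fun w => z w j) >>.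

End borel_structures.

Section conditional_expectation.
Context d (W : measurableType d) (R : realType) (P : probability W R).
Implicit Types G : set (set W).

Definition expectation_mx m (X : W -> 'M[R[i]]_m) : 'M[R[i]]_m :=
  complex_mx (\matrix_(i, j) fine 'E_P[fun w => complex.Re (X w i j)])
             (\matrix_(i, j) fine 'E_P[fun w => complex.Im (X w i j)]).

(* [Y] is a version of E[X | G]; versions exist for integrable [X] and are
   unique up to almost sure equality. *)
Definition is_cond_exp G (X Y : W -> R) : Prop :=
  [/\ P.-integrable setT (EFin \o X),
      P.-integrable setT (EFin \o Y),
      measurable_wrt G (measurable : set (set R)) Y &
      forall A, G A -> (\int[P]_(w in A) (Y w)%:E = \int[P]_(w in A) (X w)%:E)%E].

Definition is_cond_exp_mx G m (X Y : W -> 'M[R[i]]_m) : Prop :=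
  forall i j,
    is_cond_exp G (fun w => complex.Re (X w i j)) (fun w => complex.Re (Y w i j)) /\
    is_cond_exp G (fun w => complex.Im (X w i j)) (fun w => complex.Im (Y w i j)).

Definition is_cond_prob G (A : set W) (q : W -> R) : Prop :=
  is_cond_exp G \1_A q.

(* By almost sure uniqueness, requiring the next two properties of some versions
   of the conditional probabilities is the same as requiring them of all. *)
Definition cond_identically_distributed G (T : topologicalType)
    (X Y : W -> T) : Prop :=
  forall B, borel B ->
    exists2 q, is_cond_prob G (X @^-1` B) q & is_cond_prob G (Y @^-1` B) q.

Definition cond_independent G (T : topologicalType) (X Y : W -> T) : Prop :=
  forall B C, borel B -> borel C ->
    exists q r, [/\ is_cond_prob G (X @^-1` B) q,
                    is_cond_prob G (Y @^-1` C) r &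
                    is_cond_prob G (X @^-1` B `&` Y @^-1` C)
                      (fun w => q w * r w)].

Definition cond_iid G (T : topologicalType) (X Y : W -> T) : Prop :=
  cond_independent G X Y /\ cond_identically_distributed G X Y.

End conditional_expectation.

(* Main.v *)
Require Import Defs.
From HB Require Import structures.
From mathcomp Require Import all_boot all_order all_algebra.
From mathcomp Require Import ring lra.
From mathcomp Require Import complex.
From mathcomp Require Import all_classical all_reals all_analysis.
From mathcomp Require Import measurable_realfun.

Set Implicit Arguments.
Unset Strict Implicit.
Unset Printing Implicit Defensive.

Import Order.TTheory GRing.Theory Num.Theory.
Import numFieldNormedType.Exports.

Local Open Scope classical_set_scope.
Local Open Scope ring_scope.
Local Open Scope sesquilinear_scope.

(* Method of exchangeable pairs. Write X = H(z) - E H(z) and let z_k be z with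
   its k-th coordinate resampled. The pair (z, z_k) is exchangeable, and
   E[H(z_k) | z] = E[H(z) | (Z_j)_(j <> k)]. Self-reproduction therefore gives
     s E tr X e^(th X)
       = 1/2 sum_k E tr (H(z) - H(z_k)) (e^(th X) - e^(th X_k)),
   and the mean value trace inequality
     tr (A - B)(e^(th A) - e^(th B)) <= th/2 tr (A - B)^2 (e^(th A) + e^(th B)),
   which is scalar in the joint eigenbases of A and B, bounds this by
   th/2 sum_k E tr A_k^2 e^(th X) <= th L/2 E tr e^(th X). So m(th) = E tr e^(th X)
   satisfies m' <= (th L/2s) m, whence m(th) <= d e^(th^2 L/4s), and the Laplace
   transform method concludes. To avoid differentiating under the integral,
   the differential inequality is replaced by the backward difference
   e^(t a) - e^(t' a) <= (t - t') a e^(t a). *)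

(** * The trace pairing and the functional calculus of Hermitian matrices *)

Section complex_facts.
Context {R : realType}.
Implicit Types x y : R[i].

(** The hypothesis only describes the law of [(Z_k', Z_k)] given the other coordinates, so
    exchangeability of the full pair has to be built. It is checked on boxes, where both sides are
    the expectation of one symmetric product of conditional probabilities, and a pi-lambda argument
    extends it; the Borel sets of the product are generated by boxes because the factors are
    separable metric spaces. Versions of conditional probabilities truncated to [0, 1] stand in for
    regular conditional laws. Eigenbases are chosen without any measurability, so e^(th X) and the
    largest eigenvalue are shown measurable as limits of functions of the entries. On constants:
    antisymmetrizing costs a factor 1/2, which is regained because the two exponentials of the mean
    value inequality contribute equally by exchangeability. The norm is taken once, after summing
    over k, so L is the norm of the sum. Integrating th L / 2s gives th^2 L / 4s, and th^2 L / 4s -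
    th t is least at th = 2 s t / L; for L = 0 there is no minimizer and th has to grow without
    bound. *)

Lemma cReD x y : complex.Re (x + y) = complex.Re x + complex.Re y.
Proof. by case: x; case: y. Qed.

Lemma cImD x y : complex.Im (x + y) = complex.Im x + complex.Im y.
Proof. by case: x; case: y. Qed.

Lemma cReN x : complex.Re (- x) = - complex.Re x.
Proof. by case: x. Qed.

Lemma cImN x : complex.Im (- x) = - complex.Im x.
Proof. by case: x. Qed.

Lemma cReM x y : complex.Re (x * y) =
  complex.Re x * complex.Re y - complex.Im x * complex.Im y.
Proof. by case: x; case: y. Qed.

Lemma cImM x y : complex.Im (x * y) =
  complex.Re x * complex.Im y + complex.Im x * complex.Re y.
Proof. by case: x => a b; case: y => c e /=; rewrite addrC. Qed.

Lemma cReCM (a : R) x : complex.Re (a%:C%C * x) = a * complex.Re x.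
Proof. by case: x => b c /=; rewrite mul0r subr0. Qed.

Lemma cImCM (a : R) x : complex.Im (a%:C%C * x) = a * complex.Im x.
Proof. by case: x => b c /=; rewrite mul0r addr0. Qed.

Lemma cRe_conjc x : complex.Re (x^*) = complex.Re x.
Proof. by case: x. Qed.

Lemma cIm_conjc x : complex.Im (x^*) = - complex.Im x.
Proof. by case: x. Qed.

Lemma cRe_sum (I : Type) (r : seq I) (P : pred I) (F : I -> R[i]) :
  complex.Re (\sum_(i <- r | P i) F i) = \sum_(i <- r | P i) complex.Re (F i).
Proof. by apply: (big_morph (@complex.Re R)) => // x y; exact: cReD. Qed.

Lemma cIm_sum (I : Type) (r : seq I) (P : pred I) (F : I -> R[i]) :
  complex.Im (\sum_(i <- r | P i) F i) = \sum_(i <- r | P i) complex.Im (F i).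
Proof. by apply: (big_morph (@complex.Im R)) => // x y; exact: cImD. Qed.

Definition absq x : R := complex.Re x ^+ 2 + complex.Im x ^+ 2.

Lemma absq_ge0 x : 0 <= absq x.
Proof. by rewrite addr_ge0 ?sqr_ge0. Qed.

Lemma mul_conj x : x * x^* = (absq x)%:C%C.
Proof.
case: x => a b; rewrite /absq /=; apply/eqP; rewrite eq_complex /=.
by apply/andP; split; apply/eqP; ring.
Qed.

End complex_facts.

Section hermitian.
Context {R : realType} {d : nat}.
Implicit Types A B M N : 'M[R[i]]_d.

(* On Hermitian matrices, the real Hilbert-Schmidt inner product. *)
Definition hs A B : R := complex.Re (\tr (A *m B)).

Lemma hsC A B : hs A B = hs B A.
Proof. by rewrite /hs mxtrace_mulC. Qed.

Lemma hsDl A B M : hs (A + B) M = hs A M + hs B M.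
Proof. by rewrite /hs mulmxDl raddfD cReD. Qed.

Lemma hsNl A M : hs (- A) M = - hs A M.
Proof. by rewrite /hs mulNmx raddfN cReN. Qed.

Lemma hsBl A B M : hs (A - B) M = hs A M - hs B M.
Proof. by rewrite hsDl hsNl. Qed.

Lemma hsDr A B M : hs M (A + B) = hs M A + hs M B.
Proof. by rewrite hsC hsDl !(hsC _ M). Qed.

Lemma hsBr A B M : hs M (A - B) = hs M A - hs M B.
Proof. by rewrite hsC hsBl !(hsC _ M). Qed.

Lemma hsZl (a : R) A M : hs (a%:C%C *: A) M = a * hs A M.
Proof. by rewrite /hs -scalemxAl linearZ /= cReCM. Qed.

Lemma hsMl A B M : hs (A *m B) M = hs A (B *m M).
Proof. by rewrite /hs mulmxA. Qed.

Lemma hsMr A B M : hs (A *m B) M = hs B (M *m A).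
Proof. by rewrite /hs -mulmxA mxtrace_mulC mulmxA. Qed.

Lemma hs_suml (I : Type) (r : seq I) (P : pred I) (F : I -> 'M[R[i]]_d) M :
  hs (\sum_(i <- r | P i) F i) M = \sum_(i <- r | P i) hs (F i) M.
Proof.
apply: (big_morph (fun A => hs A M)) => [A B|]; first exact: hsDl.
by rewrite /hs mul0mx mxtrace0.
Qed.

Lemma hsE A B : hs A B = \sum_i \sum_j
  (complex.Re (A i j) * complex.Re (B j i)
   - complex.Im (A i j) * complex.Im (B j i)).
Proof.
rewrite /hs /mxtrace cRe_sum; apply: eq_bigr => i _.
by rewrite mxE cRe_sum; apply: eq_bigr => j _; rewrite cReM.
Qed.

Definition eigval A (i : 'I_d) : R := complex.Re (spectral_diag A 0 i).

(* Functional calculus; meaningful for Hermitian [A], where [eigval A] lists the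
   eigenvalues with multiplicity. *)
Definition fmx (f : R -> R) A : 'M[R[i]]_d :=
  (spectralmx A)^t* *m diag_mx (\row_i (f (eigval A i))%:C%C) *m spectralmx A.

Lemma hermsymE A : (A \is hermsymmx) = (A == A^t*).
Proof. by rewrite is_hermitianmxE expr0 scale1r. Qed.

Lemma spectralmxK A : spectralmx A *m (spectralmx A)^t* = 1%:M.
Proof. by apply/unitarymxP; exact: spectral_unitarymx. Qed.

Lemma spectralmxKC A : (spectralmx A)^t* *m spectralmx A = 1%:M.
Proof. by apply: mulmx1C; exact: spectralmxK. Qed.

(** The spectral theorem in unitary form. Hermitian symmetry makes the spectral diagonal real, so
    taking real parts in [eigval] loses nothing. *)
Lemma fmx_id A : A \is hermsymmx -> fmx id A = A.
Proof.
move=> hA; have := orthomx_spectralP (hermitian_normalmx hA).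
rewrite /fmx; set U := spectralmx A.
have -> : invmx U = U^t* by apply: invmx_unitary; exact: spectral_unitarymx.
move/esym; apply: etrans; congr (fun D => U^t* *m diag_mx D *m U).
apply/rowP => i; rewrite mxE; apply: RRe_real.
exact: (mxOverP (hermitian_spectral_diag_real hA)).
Qed.

Lemma fmxM f g A : fmx f A *m fmx g A = fmx (fun x => f x * g x) A.
Proof.
rewrite /fmx; move: (spectralmxK A).
move: (spectralmx A) (_^t*) => U V UV.
set D := diag_mx _; set D' := diag_mx _.
have -> : V *m D *m U *m (V *m D' *m U) = V *m (D *m (U *m V) *m D') *m U.
  by rewrite !mulmxA.
rewrite UV mulmx1 mulmx_diag.
by congr (fun D => V *m diag_mx D *m U); apply/rowP => i; rewrite !mxE rmorphM.
Qed.

Lemma fmx1 A : fmx (fun=> 1) A = 1%:M.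
Proof.
rewrite /fmx [diag_mx _](_ : _ = 1%:M) ?mulmx1 ?spectralmxKC //.
by rewrite -diag_const_mx; congr diag_mx; apply/rowP => i; rewrite !mxE.
Qed.

(* [|<u_i, v_j>|^2] for the eigenbases [u] of [A] and [v] of [B]: a doubly
   stochastic array that turns trace identities into scalar ones. *)
Definition overlap A B i j : R :=
  absq ((spectralmx A *m (spectralmx B)^t*) i j).

Lemma overlap_ge0 A B i j : 0 <= overlap A B i j.
Proof. exact: absq_ge0. Qed.

Lemma overlap_suml A B i : \sum_j overlap A B i j = 1.
Proof.
pose W := spectralmx A *m (spectralmx B)^t*.
have : (W *m W^t*) i i = 1.
  rewrite /W trmx_mul map_mxM trmxCK mulmxA mulmxKtV ?spectral_unitarymx //.
  by rewrite spectralmxK mxE eqxx.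
move/(congr1 (@complex.Re R)); rewrite mxE cRe_sum /= => <-.
by apply: eq_bigr => j _; rewrite /overlap !mxE -/W mul_conj.
Qed.

Lemma overlapC A B i j : overlap A B i j = overlap B A j i.
Proof.
rewrite /overlap.
have -> : spectralmx A *m (spectralmx B)^t* =
          (spectralmx B *m (spectralmx A)^t*)^t*.
  by rewrite trmx_mul map_mxM trmxCK.
by rewrite !mxE /absq cRe_conjc cIm_conjc sqrrN.
Qed.

(** By cyclicity the trace only sees the eigenbases through the unitary [W], and each diagonal entry
    collects the terms [W i j] times its conjugate. *)
Lemma hs_fmx f g A B : hs (fmx f A) (fmx g B) =
  \sum_i \sum_j overlap A B i j * (f (eigval A i) * g (eigval B j)).
Proof.
set U := spectralmx A; set V := spectralmx B; pose W := U *m V^t*.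
rewrite /fmx -/U -/V hsMr /hs.
have -> : U *m (V^t* *m diag_mx (\row_j (g (eigval B j))%:C%C) *m V *m
      (U^t* *m diag_mx (\row_i (f (eigval A i))%:C%C))) =
   W *m (diag_mx (\row_j (g (eigval B j))%:C%C) *m
     (W^t* *m diag_mx (\row_i (f (eigval A i))%:C%C))).
  by rewrite /W trmx_mul map_mxM trmxCK !mulmxA.
rewrite /overlap -/U -/V -/W; clearbody W.
rewrite /mxtrace cRe_sum; apply: eq_bigr => i _.
rewrite mxE cRe_sum; apply: eq_bigr => j _.
rewrite mul_diag_mx mul_mx_diag !mxE.
set x := W i j; rewrite [X in complex.Re X](_ : _ =
  (absq x * (f (eigval A i) * g (eigval B j)))%:C%C) //.
rewrite !rmorphM /= -mul_conj -/x; ring.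
Qed.

Lemma tr_fmx f A : complex.Re (\tr (fmx f A)) = \sum_i f (eigval A i).
Proof.
rewrite /fmx -mulmxA mxtrace_mulC -mulmxA spectralmxK mulmx1 mxtrace_diag.
by rewrite cRe_sum; apply: eq_bigr => i _; rewrite mxE.
Qed.

End hermitian.

(** * The mean value trace inequality *)

(* Equivalent to [tanh u <= u] at [u = t / 2]. *)
Lemma expR_pade (R : realType) (t : R) : 0 <= t ->
  expR t * (2 - t) <= 2 + t.
Proof.
move=> t0; pose g (x : R) : R := (2 + x) - expR x * (2 - x).
pose g' (x : R) : R := 1 - expR x * (1 - x).
have dg (x : R) : is_derive x 1 g (g' x).
  rewrite /g; apply: is_derive_eq.
 by rewrite /g' -![_ *: _]/(_ * _); ring.
have cg : {within `[0, t], continuous g}.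
  by apply: derivable_within_continuous => x _; case: (dg x).
(* [g] vanishes at 0, so the mean value theorem leaves only the sign of [g'], which is
   [1 - c <= expR (- c)] multiplied by [expR c]. *)
have [c /andP[c0 _]] := MVT_segment t0 (fun x _ => dg x) cg.
rewrite /g expR0 subr0 addr0 mul1r subrr !subr0 => E.
have : 0 <= g' c * t.
  apply: mulr_ge0 => //; rewrite subr_ge0 -[leRHS](expRxMexpNx_1 c).
  by apply: ler_wpM2l; [exact: expR_ge0|exact: expR_ge1Dx].
by rewrite -E subr_ge0.
Qed.

(* Hermite-Hadamard for the convex function exp. *)
Lemma expR_diff_le (R : realType) (x y : R) :
  (x - y) * (expR x - expR y) <= (x - y) ^+ 2 / 2 * (expR x + expR y).
Proof.
wlog xy : x y / y <= x.
  move=> h; have [/h//|/ltW /h] := leP y x.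
  by rewrite -(opprB x y) -(opprB (expR x)) mulrNN sqrrN (addrC (expR y)).
(* Dividing by [expR y] leaves a one-variable inequality in [x - y]. *)
have := expR_pade (t := x - y); rewrite subr_ge0 => /(_ xy).
have -> : expR x = expR y * expR (x - y) by rewrite -expRD addrC subrK.
move=> /(ler_wpM2l (expR_ge0 y)) h; nra.
Qed.

Section trace_inequality.
Context {R : realType} {d : nat}.
Implicit Types (A B : 'M[R[i]]_d) (f : R -> R).

Lemma mulmx_fmxl f A : A \is hermsymmx ->
  A *m fmx f A = fmx (fun x => x * f x) A.
Proof. by move=> /fmx_id hA; rewrite -{1}hA fmxM. Qed.

Lemma mulmx_fmxr f A : A \is hermsymmx ->
  fmx f A *m A = fmx (fun x => x * f x) A.
Proof.
move=> /fmx_id hA; rewrite -{2}hA fmxM; congr (fmx _ A).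
by apply/funext => x; rewrite mulrC.
Qed.

(** Reading [1%:M] as a function of [B] spreads a trace in [A] alone over the joint array, where it
    can be combined with mixed terms. *)
Lemma hs_fmx_one f A B :
  hs (fmx f A) 1%:M = \sum_i \sum_j overlap A B i j * f (eigval A i).
Proof.
rewrite -(fmx1 B) hs_fmx.
by apply: eq_bigr => i _; apply: eq_bigr => j _; rewrite mulr1.
Qed.

Lemma hs_one_fmx f A B :
  hs (fmx f B) 1%:M = \sum_i \sum_j overlap A B i j * f (eigval B j).
Proof.
rewrite (hs_fmx_one f B A) exchange_big /=.
by apply: eq_bigr => i _; apply: eq_bigr => j _; rewrite overlapC.
Qed.

Lemma hs_mul1 A B : hs A B = hs (A *m B) 1%:M.
Proof. by rewrite /hs mulmx1. Qed.

Lemma hs_fmx_diff f A B : A \is hermsymmx -> B \is hermsymmx ->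
  hs (A - B) (fmx f A - fmx f B) = \sum_i \sum_j overlap A B i j *
    ((eigval A i - eigval B j) * (f (eigval A i) - f (eigval B j))).
Proof.
move=> hA hB; rewrite hsBl !hsBr.
rewrite (hs_mul1 A (fmx f A)) (hs_mul1 B (fmx f B)) !mulmx_fmxl //.
rewrite (hs_fmx_one _ A B) (hs_one_fmx _ A B) (hsC B).
have -> : hs A (fmx f B) = hs (fmx id A) (fmx f B) by rewrite fmx_id.
have -> : hs (fmx f A) B = hs (fmx f A) (fmx id B) by rewrite (fmx_id hB).
rewrite !hs_fmx -!sumrB; apply: eq_bigr => i _.
by rewrite -!sumrB; apply: eq_bigr => j _; ring.
Qed.

Lemma hs_sq_fmxl f A B : A \is hermsymmx -> B \is hermsymmx ->
  hs ((A - B) *m (A - B)) (fmx f A) = \sum_i \sum_j overlap A B i j *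
    ((eigval A i - eigval B j) ^+ 2 * f (eigval A i)).
Proof.
move=> hA hB.
rewrite mulmxBl !mulmxBr !hsBl (hs_mul1 (A *m A)) (hsMr A B) (hsMl B A).
rewrite -mulmxA !mulmx_fmxl // mulmx_fmxr // (hs_fmx_one _ A B) (hsC B).
have -> : hs (fmx (fun x => x * f x) A) B =
  hs (fmx (fun x => x * f x) A) (fmx id B) by rewrite (fmx_id hB).
have -> : hs (B *m B) (fmx f A) = hs (fmx f A) (fmx (fun x => x * x) B).
  by rewrite -(mulmx_fmxl id) // fmx_id // hsC.
rewrite !hs_fmx -!sumrB; apply: eq_bigr => i _.
by rewrite -!sumrB; apply: eq_bigr => j _; ring.
Qed.

Lemma hs_sq_fmxr f A B : A \is hermsymmx -> B \is hermsymmx ->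
  hs ((A - B) *m (A - B)) (fmx f B) = \sum_i \sum_j overlap A B i j *
    ((eigval A i - eigval B j) ^+ 2 * f (eigval B j)).
Proof.
move=> hA hB; have -> : (A - B) *m (A - B) = (B - A) *m (B - A).
  by rewrite -[B - A]opprB mulmxN mulNmx opprK.
rewrite hs_sq_fmxl // exchange_big /=; apply: eq_bigr => i _.
by apply: eq_bigr => j _; rewrite overlapC -sqrrN opprB.
Qed.

Lemma mean_value_trace (th : R) A B : A \is hermsymmx -> B \is hermsymmx ->
  0 <= th ->
  hs (A - B) (fmx (fun x => expR (th * x)) A - fmx (fun x => expR (th * x)) B)
  <= th / 2 * hs ((A - B) *m (A - B))
      (fmx (fun x => expR (th * x)) A + fmx (fun x => expR (th * x)) B).
Proof.
rewrite le_eqVlt => hA hB /predU1P[<-|th0].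
  rewrite !mul0r; set f := fun x => _; have -> : f = fun=> 1.
    by apply/funext => x; rewrite /f mul0r expR0.
  by rewrite !fmx1 subrr /hs mulmx0 mxtrace0.
rewrite hs_fmx_diff // hsDr hs_sq_fmxl // hs_sq_fmxr // -big_split mulr_sumr /=.
apply: ler_sum => i _; rewrite -big_split mulr_sumr /=; apply: ler_sum => j _.
rewrite -mulrDr !(mulrCA _ (overlap A B i j)); apply: ler_wpM2l; rewrite ?overlap_ge0 // -mulrDr.
(* The factor [th] turns the difference of eigenvalues into the difference of exponents, to which
   the scalar inequality applies. *)
rewrite -(ler_pM2l th0); have := expR_diff_le (th * eigval A i) (th * eigval B j).
by rewrite -mulrBr exprMn; nra.
Qed.

End trace_inequality.

(** * Spectral norm and largest eigenvalue *)

Section spectrum.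
Context {R : realType} {d : nat}.
Implicit Types (A B P : 'M[R[i]]_d) (f : R -> R).

(** [spectralmx] stores left eigenvectors as rows; the conjugate transpose gives right eigenvectors
    as columns. *)
Definition eigvec A (j : 'I_d) : 'cV[R[i]]_d := col j ((spectralmx A)^t*).

Lemma sandwich_spectral f A :
  spectralmx A *m fmx f A *m (spectralmx A)^t* =
  diag_mx (\row_i (f (eigval A i))%:C%C).
Proof.
rewrite /fmx; set D := diag_mx _; move: (spectralmxK A).
move: (spectralmx A) (_^t*) => U V UV.
have -> : U *m (V *m D *m U) *m V = (U *m V) *m D *m (U *m V).
  by rewrite !mulmxA.
by rewrite UV mul1mx mulmx1.
Qed.

Lemma mulmx_eigvec A j : A \is hermsymmx ->
  A *m eigvec A j = (eigval A j)%:C%C *: eigvec A j.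
Proof.
move=> /fmx_id hA; have := sandwich_spectral id A; rewrite hA /eigvec.
move: (spectralmxKC A); move: (spectralmx A) (_^t*) => U V VU.
move=> /(congr1 (mulmx V)); rewrite !mulmxA VU mul1mx => AV.
apply/matrixP => k l; have := AV => /matrixP/(_ k j).
rewrite mul_mx_diag !mxE mulrC => <-.
by apply: eq_bigr => i _; rewrite mxE.
Qed.

(** Left eigenvectors are needed because [eigenvalue] is defined through row vectors. *)
Lemma row_mulmx_spectral A j : A \is hermsymmx ->
  row j (spectralmx A) *m A = (eigval A j)%:C%C *: row j (spectralmx A).
Proof.
move=> /fmx_id hA; have := sandwich_spectral id A; rewrite hA.
move: (spectralmxKC A); move: (spectralmx A) (_^t*) => U V VU.
move=> /(congr1 (mulmx^~ U)); rewrite -!mulmxA VU mulmx1 => UA.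
by rewrite -row_mul UA; apply/rowP => k; rewrite mul_diag_mx !mxE.
Qed.

Lemma eigvalE A j : A \is hermsymmx ->
  (eigval A j)%:C%C = ((eigvec A j)^t* *m A *m eigvec A j) 0 0.
Proof.
move=> hA; rewrite -mulmxA mulmx_eigvec // -scalemxAr mxE.
suff -> : ((eigvec A j)^t* *m eigvec A j) 0 0 = 1 by rewrite mulr1.
have := spectralmxK A => /matrixP/(_ j j); rewrite [in RHS]mxE eqxx mulr1n => <-.
by rewrite !mxE; apply: eq_bigr => k _; rewrite !mxE conjCK.
Qed.

Lemma eigval_psd P j : psdmx P -> 0 <= eigval P j.
Proof.
by case=> hP /(_ (eigvec P j)); rewrite -eigvalE // ler0c.
Qed.

(** Allows a Loewner inequality to be tested against a matrix exponential under the trace. *)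
Lemma hs_psd_fmx P f A : psdmx P -> (forall x, 0 <= f x) -> 0 <= hs P (fmx f A).
Proof.
move=> psdP f0; have [hP _] := psdP.
have -> : hs P (fmx f A) = hs (fmx id P) (fmx f A) by rewrite fmx_id.
rewrite hs_fmx; apply: sumr_ge0 => i _; apply: sumr_ge0 => j _.
by rewrite mulr_ge0 ?overlap_ge0 // mulr_ge0 // eigval_psd.
Qed.

Lemma sum_absq_spectral A j : \sum_k absq (spectralmx A j k) = 1.
Proof.
have := spectralmxK A => /matrixP/(_ j j); rewrite [in RHS]mxE eqxx mulr1n.
move=> /(congr1 (@complex.Re R)); rewrite mxE cRe_sum /= => <-.
by apply: eq_bigr => k _; rewrite !mxE mul_conj.
Qed.

Lemma absq_spectral_le1 A j k : absq (spectralmx A j k) <= 1.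
Proof.
rewrite -(sum_absq_spectral A j) (bigD1 k) //= lerDl.
by apply: sumr_ge0 => ? _; exact: absq_ge0.
Qed.

Lemma l2norm_eigvec A j : l2norm (eigvec A j) = 1.
Proof.
rewrite /l2norm -[RHS]sqrtr1 -(sum_absq_spectral A j); congr Num.sqrt.
by apply: eq_bigr => k _; rewrite !mxE cRe_conjc cIm_conjc sqrrN.
Qed.

Lemma l2normZ (a : R) (u : 'cV[R[i]]_d) : l2norm (a%:C%C *: u) = `|a| * l2norm u.
Proof.
rewrite /l2norm -sqrtr_sqr -sqrtrM ?sqr_ge0 // mulr_sumr; congr Num.sqrt.
by apply: eq_bigr => k _; rewrite !mxE cReCM cImCM !exprMn mulrDr.
Qed.

Lemma Re_le_l2norm (u : 'cV[R[i]]_d) i : `|complex.Re (u i 0)| <= l2norm u.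
Proof.
rewrite -sqrtr_sqr ler_wsqrtr // (bigD1 i) //= -addrA lerDl.
by rewrite addr_ge0 ?sqr_ge0 // sumr_ge0 // => j _; exact: absq_ge0.
Qed.

Lemma Im_le_l2norm (u : 'cV[R[i]]_d) i : `|complex.Im (u i 0)| <= l2norm u.
Proof.
rewrite -sqrtr_sqr ler_wsqrtr // (bigD1 i) //= addrAC lerDr.
by rewrite addr_ge0 ?sqr_ge0 // sumr_ge0 // => j _; exact: absq_ge0.
Qed.

Lemma spectral_norm_ub A (u : 'cV[R[i]]_d) :
  l2norm u <= 1 -> l2norm (A *m u) <= spectral_norm A.
Proof.
move=> u1; rewrite /spectral_norm; apply: ub_le_sup; last by exists u.
(* The supremum is meaningful only for a bounded set: on the unit ball, the row sum [K i] dominates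
   the real and imaginary parts of coordinate [i] of the image. *)
pose K i := \sum_j (`|complex.Re (A i j)| + `|complex.Im (A i j)|).
exists (Num.sqrt (\sum_i (K i ^+ 2 + K i ^+ 2))) => _ /= [{u1}u u1 <-].
have re1 j : `|complex.Re (u j 0)| <= 1 by exact: le_trans (Re_le_l2norm u j) u1.
have im1 j : `|complex.Im (u j 0)| <= 1 by exact: le_trans (Im_le_l2norm u j) u1.
have bd (a b x y : R) : `|x| <= 1 -> `|y| <= 1 ->
    `|a * x + b * y| <= `|a| + `|b|.
  move=> x1 y1; rewrite (le_trans (ler_normD _ _)) // !normrM.
  by rewrite lerD // ler_piMr.
apply: ler_wsqrtr; apply: ler_sum => i _; rewrite mxE cRe_sum cIm_sum.
have K0 : 0 <= K i by apply: sumr_ge0 => j _; rewrite addr_ge0.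
have sqK (y : R) : `|y| <= K i -> y ^+ 2 <= K i ^+ 2.
  by move=> yK; rewrite -real_normK ?num_real // lerXn2r // nnegrE.
apply: lerD; apply: sqK; apply: le_trans (ler_norm_sum _ _ _) _;
  apply: ler_sum => j _.
- by rewrite cReM -mulNr -(normrN (complex.Im (A i j))) bd.
- by rewrite cImM bd.
Qed.

Lemma eigval_le_spectral_norm A j : A \is hermsymmx ->
  eigval A j <= spectral_norm A.
Proof.
move=> hA; rewrite (le_trans (ler_norm _)) //.
have := @spectral_norm_ub A (eigvec A j).
by rewrite mulmx_eigvec // l2normZ l2norm_eigvec mulr1; apply.
Qed.

Lemma spectral_norm_ge0 A : 0 <= spectral_norm A.
Proof.
have := @spectral_norm_ub A 0; rewrite mulmx0.
suff -> : l2norm (0 : 'cV[R[i]]_d) = 0 by apply.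
by rewrite /l2norm big1 ?sqrtr0 // => i _; rewrite mxE /= expr0n addr0.
Qed.

(** Each eigenvalue of [P] is at most the norm, and the overlaps in a row sum to one, so only the
    trace of [fmx f A] remains. *)
Lemma hs_le_spectral_norm P f A : P \is hermsymmx -> (forall x, 0 <= f x) ->
  hs P (fmx f A) <= spectral_norm P * \sum_i f (eigval A i).
Proof.
move=> hP f0.
have -> : hs P (fmx f A) = hs (fmx f A) (fmx id P) by rewrite fmx_id // hsC.
rewrite hs_fmx mulr_sumr; apply: ler_sum => i _.
rewrite -[leRHS]mul1r -(overlap_suml A P i) mulr_suml; apply: ler_sum => j _.
apply: ler_wpM2l; first exact: overlap_ge0.
by rewrite mulrC ler_wpM2r // eigval_le_spectral_norm.
Qed.

(** Testing the norm on a basis vector turns a bound on the spectral norm into entrywise bounds,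
    hence into bounded real functions. *)
Lemma entry_le_spectral_norm A i j :
  `|complex.Re (A i j)| <= spectral_norm A /\
  `|complex.Im (A i j)| <= spectral_norm A.
Proof.
pose e : 'cV[R[i]]_d := delta_mx j 0.
have e1 : l2norm e <= 1.
  rewrite /l2norm (bigD1 j) //= big1 ?addr0 => [|k kj].
    by rewrite mxE !eqxx /= expr1n expr0n addr0 sqrtr1.
  by rewrite mxE (negbTE kj) /= !expr0n addr0.
have := spectral_norm_ub A e1; rewrite -colE => h.
have := Re_le_l2norm (col j A) i; have := Im_le_l2norm (col j A) i.
by rewrite mxE => h1 h2; split; [exact: le_trans h2 h|exact: le_trans h1 h].
Qed.

End spectrum.

(** * The matrix exponential and the largest eigenvalue *)

Section matrix_exponential.
Context {R : realType} {d : nat}.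
Implicit Types (A B P : 'M[R[i]]_d) (f : R -> R).

Lemma eigenvalue_eigval A (x : R) : A \is hermsymmx ->
  eigenvalue A (x%:C)%C <-> exists i, x = eigval A i.
Proof.
move=> hA; split.
  move=> /eigenvalueP [v vA v0].
  have := sandwich_spectral id A; rewrite fmx_id //.
  move: (spectralmxKC A); move: (spectralmx A) (_^t*) => U V VU UAV.
  (* [y] holds the coordinates of [v] in the eigenbasis; any nonzero coordinate identifies [x] as
     the corresponding eigenvalue. *)
  pose y := v *m V.
  have y0 : y != 0.
    by apply: contraNneq v0 => y0; rewrite -[v]mulmx1 -VU mulmxA -/y y0 mul0mx.
  have /rV0Pn [j yj] := y0; exists j.
  have : y *m (U *m A *m V) = (x%:C)%C *: y.
    rewrite /y scalemxAl -vA -!mulmxA.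
    by rewrite (mulmxA V U) VU mul1mx.
  clearbody y; rewrite UAV => /rowP/(_ j); rewrite mul_mx_diag !mxE mulrC.
  by move=> E; have := mulIf yj E => /complexI ->.
case=> j ->; apply/eigenvalueP; exists (row j (spectralmx A)).
  exact: row_mulmx_spectral.
apply/eqP => r0; have := sum_absq_spectral A j; rewrite big1 => [/eqP|k _].
  by rewrite eq_sym oner_eq0.
have /rowP/(_ k) := r0; rewrite !mxE => ->.
by rewrite /absq /= expr0n addr0.
Qed.

Lemma lambda_max_attained A : (0 < d)%N -> A \is hermsymmx ->
  exists i, lambda_max A = eigval A i.
Proof.
move=> d0 hA; pose i0 : 'I_d := Ordinal d0.
exists [arg max_(i > i0) eigval A i]%O.
case: arg_maxP => //= k _ kmax; apply/eqP; rewrite eq_le; apply/andP; split.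
  apply: ge_sup; first by exists (eigval A k); apply/eigenvalue_eigval => //; exists k.
  by move=> x /eigenvalue_eigval - /(_ hA) [i ->]; exact: kmax.
apply: ub_le_sup; last by apply/eigenvalue_eigval => //; exists k.
exists (eigval A k) => x /eigenvalue_eigval - /(_ hA) [i ->]; exact: kmax.
Qed.

Lemma eigval_le_lambda_max A i : A \is hermsymmx -> eigval A i <= lambda_max A.
Proof.
move=> hA; have d0 : (0 < d)%N by case: d i => // -[].
apply: ub_le_sup; last by apply/eigenvalue_eigval => //; exists i.
exists (\sum_j `|eigval A j|) => x /eigenvalue_eigval - /(_ hA) [j ->].
rewrite (bigD1 j) //= (le_trans (ler_norm _)) // lerDl.
by apply: sumr_ge0.
Qed.

Definition texp (th : R) A := fmx (fun x => expR (th * x)) A.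

Lemma expR_lambda_max_le A (th : R) : (0 < d)%N -> A \is hermsymmx ->
  expR (th * lambda_max A) <= complex.Re (\tr (texp th A)).
Proof.
move=> d0 hA; rewrite tr_fmx; have [i ->] := lambda_max_attained d0 hA.
rewrite (bigD1 i) //= lerDl; apply: sumr_ge0 => j _; exact: expR_ge0.
Qed.

(** Together with the lower bound by the top eigenvalue, this squeezes [ln] of the trace divided by
    [th] to within [ln d%:R / th] of [lambda_max A]. *)
Lemma tr_texp_le A (th : R) : A \is hermsymmx -> 0 <= th ->
  complex.Re (\tr (texp th A)) <= d%:R * expR (th * lambda_max A).
Proof.
move=> hA th0; rewrite tr_fmx -[X in X%:R]card_ord mulr_natl -sumr_const.
by apply: ler_sum => i _; rewrite ler_expR ler_wpM2l // eigval_le_lambda_max.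
Qed.

(** [hs A A] is the squared Hilbert-Schmidt norm, a polynomial in the entries, so it controls
    eigenvalues uniformly over a bounded family. *)
Lemma eigval_sqr_le A k : A \is hermsymmx -> eigval A k ^+ 2 <= hs A A.
Proof.
move=> hA; have -> : hs A A = \sum_i eigval A i ^+ 2.
  rewrite /hs -{1 2}(fmx_id hA) fmxM tr_fmx.
  by apply: eq_bigr => i _; rewrite expr2.
by rewrite (bigD1 k) //= lerDl; apply: sumr_ge0 => j _; exact: sqr_ge0.
Qed.

(** Entry [(i, j)] of the orthogonal projection onto the [k]-th eigenvector. *)
Definition specw A i j k : R[i] := (spectralmx A k i)^* * spectralmx A k j.

Lemma fmxE f A i j : fmx f A i j = \sum_k (f (eigval A k))%:C%C * specw A i j k.
Proof.
rewrite /fmx mxE; apply: eq_bigr => k _.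
by rewrite mul_mx_diag !mxE /specw mulrA [_ * _%:C%C]mulrC.
Qed.

Lemma Re_fmx f A i j :
  complex.Re (fmx f A i j) = \sum_k f (eigval A k) * complex.Re (specw A i j k).
Proof. by rewrite fmxE cRe_sum; apply: eq_bigr => k _; rewrite cReCM. Qed.

Lemma Im_fmx f A i j :
  complex.Im (fmx f A i j) = \sum_k f (eigval A k) * complex.Im (specw A i j k).
Proof. by rewrite fmxE cIm_sum; apply: eq_bigr => k _; rewrite cImCM. Qed.

Lemma specw_le1 A i j k :
  `|complex.Re (specw A i j k)| <= 1 /\ `|complex.Im (specw A i j k)| <= 1.
Proof.
have := absq_spectral_le1 A k i; have := absq_spectral_le1 A k j.
rewrite /specw cReM cImM cRe_conjc cIm_conjc /absq.
move: (complex.Re _) (complex.Im _) (complex.Re _) (complex.Im _) => a b c e.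
have amgm (x y z w : R) : x ^+ 2 + y ^+ 2 <= 1 -> z ^+ 2 + w ^+ 2 <= 1 ->
    `|x * z + y * w| <= 1.
  move=> h1 h2; have := sqr_ge0 (x - z); have := sqr_ge0 (x + z).
  have := sqr_ge0 (y - w); have := sqr_ge0 (y + w).
  by rewrite ler_norml => *; apply/andP; split; lra.
move=> h1 h2; split.
- by rewrite mulNr opprK amgm.
- by apply: amgm; rewrite ?sqrrN // addrC.
Qed.

Lemma texp_entry_le (th K : R) A i j : A \is hermsymmx -> 0 <= th ->
  hs A A <= K ^+ 2 -> 0 <= K ->
  `|complex.Re (texp th A i j)| <= d%:R * expR (th * K) /\
  `|complex.Im (texp th A i j)| <= d%:R * expR (th * K).
Proof.
move=> hA th0 AK K0; rewrite Re_fmx Im_fmx.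
have le1 k (w : R) : `|w| <= 1 ->
    `|expR (th * eigval A k) * w| <= expR (th * K).
  move=> w1; rewrite normrM ger0_norm ?expR_ge0 // -[leRHS]mulr1.
  apply: ler_pM => //; rewrite ?expR_ge0 // ler_expR ler_wpM2l //.
  rewrite (le_trans (ler_norm _)) // -(ger0_norm K0) -ler_sqr ?nnegrE //.
  by rewrite !real_normK ?num_real // (le_trans (eigval_sqr_le k hA)).
have sumc : \sum_(k < d) expR (th * K) = d%:R * expR (th * K).
  by rewrite sumr_const card_ord mulr_natl.
by split; rewrite -sumc (le_trans (ler_norm_sum _ _ _)) //; apply: ler_sum => k _;
  apply: le1; have [] := specw_le1 A i j k.
Qed.

Lemma fmx_exp A n : A \is hermsymmx -> fmx (fun x => x ^+ n) A = A ^+ n.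
Proof.
move=> hA; elim: n => [|n IHn].
  by rewrite expr0 -[RHS](fmx1 A); congr fmx; apply/funext => x; rewrite expr0.
transitivity (A *m fmx (fun x => x ^+ n) A); last by rewrite IHn exprS.
rewrite (mulmx_fmxl _ hA); apply: (congr1 (fun g => fmx g A)).
by apply/funext => x; rewrite exprS.
Qed.

Lemma exp_partial_cvg (th a : R) :
  (\sum_(k < n) (th ^+ k / k`!%:R) * a ^+ k) @[n --> \oo] --> expR (th * a).
Proof.
have := is_cvg_series_exp_coeff (th * a); rewrite /expR => h.
apply: cvg_trans h; apply: near_eq_cvg; near=> n.
rewrite /series /= big_mkord; apply: eq_bigr => k _.
by rewrite /exp_coeff /= exprMn; ring.
Unshelve. all: by end_near. Qed.

(** The partial sums are polynomials in the entries of [A], so measurability of the exponential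
    follows without any measurable choice of [spectralmx]. *)
Lemma texp_cvg (th : R) A i j : A \is hermsymmx ->
  (\sum_(k < n) (th ^+ k / k`!%:R) * complex.Re ((A ^+ k) i j)) @[n --> \oo] -->
    complex.Re (texp th A i j) /\
  (\sum_(k < n) (th ^+ k / k`!%:R) * complex.Im ((A ^+ k) i j)) @[n --> \oo] -->
    complex.Im (texp th A i j).
Proof.
move=> hA.
have swap (w : 'I_d -> R) n :
    \sum_(l < d) (\sum_(k < n) (th ^+ k / k`!%:R) * eigval A l ^+ k) * w l =
    \sum_(k < n) (th ^+ k / k`!%:R) * (\sum_(l < d) eigval A l ^+ k * w l).
  under eq_bigr do rewrite mulr_suml; rewrite exchange_big /=.
  by apply: eq_bigr => k _; rewrite mulr_sumr; apply: eq_bigr => l _; rewrite mulrA.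
have lim (w : 'I_d -> R) :
    (\sum_(k < n) (th ^+ k / k`!%:R) * (\sum_(l < d) eigval A l ^+ k * w l))
      @[n --> \oo] --> \sum_(l < d) expR (th * eigval A l) * w l.
  under eq_fun do rewrite -swap.
  by apply: (cvg_big add_continuous) => l _; apply: cvgMr_tmp; exact: exp_partial_cvg.
have ReX k : complex.Re ((A ^+ k) i j) =
    \sum_l eigval A l ^+ k * complex.Re (specw A i j l).
  by rewrite -(fmx_exp k hA) Re_fmx.
have ImX k : complex.Im ((A ^+ k) i j) =
    \sum_l eigval A l ^+ k * complex.Im (specw A i j l).
  by rewrite -(fmx_exp k hA) Im_fmx.
split.
- rewrite Re_fmx; have := lim (fun k => complex.Re (specw A i j k)).
  under eq_fun do under eq_bigr do rewrite -ReX.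
  by [].
- rewrite Im_fmx; have := lim (fun k => complex.Im (specw A i j k)).
  under eq_fun do under eq_bigr do rewrite -ImX.
  by [].
Qed.

End matrix_exponential.

(** * The Borel sets of a finite product of separable metric spaces *)

Section generated_sigma_algebras.
Context {X : Type} {G : set (set X)}.

Lemma sigma_set0 : <<s G >> set0.
Proof. exact (@sigma_algebra0 _ setT G). Qed.

Lemma sigma_compl A : <<s G >> A -> <<s G >> (~` A).
Proof. by move=> sA; rewrite -setTD; exact: sigma_algebraCD. Qed.

Lemma sigma_setT : <<s G >> setT.
Proof. by have := sigma_compl sigma_set0; rewrite setC0. Qed.

Lemma sigma_bigcup_count (I : countType) (B : I -> set X) :
  (forall i, <<s G >> (B i)) -> <<s G >> (\bigcup_i B i).
Proof.
(* Naturals that code no index contribute the empty set. *)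
move=> sB; pose C k := if unpickle k is Some i then B i else set0.
have -> : \bigcup_i B i = \bigcup_k C k.
  apply/seteqP; split => [x [i _ Bix]|x [k _]].
    by exists (pickle i) => //; rewrite /C pickleK.
  by rewrite /C; case: (unpickle k) => // i Bix; exists i.
apply: (@sigma_algebra_bigcup _ setT G) => k; rewrite /C.
by case: (unpickle k) => [i|]; [exact (sB i)|exact sigma_set0].
Qed.

Lemma sigma_forall (I : countType) (B : I -> set X) :
  (forall i, <<s G >> (B i)) -> <<s G >> [set x | forall i, B i x].
Proof.
move=> sB; have -> : [set x | forall i, B i x] = ~` \bigcup_i ~` B i.
  apply/seteqP; split => [x Bx [i _]|x nB i]; first exact.
  by apply: contrapT => nBix; apply: nB; exists i.
by apply: sigma_compl; apply: sigma_bigcup_count => i; exact: sigma_compl.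
Qed.

Lemma sigma_setI A B : <<s G >> A -> <<s G >> B -> <<s G >> (A `&` B).
Proof.
move=> sA sB; rewrite (_ : A `&` B = [set x | forall b, (if b then A else B) x]).
  by apply: sigma_forall; case.
by apply/seteqP; split => [x [? ?] []//|x h]; split; [exact: (h true)|exact: (h false)].
Qed.

End generated_sigma_algebras.

Section product_borel.
Context {n : nat} {T : 'I_n -> topologicalType}.

(** A pi-system on which events factor over the coordinates, so that conditional independence of one
    coordinate can be used. *)
Definition borel_box : set (set (prod_topology T)) :=
  [set B | exists2 C : forall k, set (T k), forall k, borel (C k) &
           B = [set x | forall k, C k (x k)]].

Lemma borel_box_setI : setI_closed borel_box.
Proof.
move=> _ _ [C bC ->] [D bD ->]; exists (fun k => C k `&` D k).
  by move=> k; exact (sigma_setI (bC k) (bD k)).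
by apply/seteqP; split => [x [Cx Dx] k|x CD]; split => // k; have [] := CD k.
Qed.

Lemma open_prod_box (U : set (prod_topology T)) (x : prod_topology T) :
  open U -> U x ->
  exists2 V : forall k, set (T k), forall k, nbhs (x k) (V k) &
    [set y : prod_topology T | forall k, V k (y k)] `<=` U.
Proof.
move=> oU Ux.
(* The boxes around [x] generate a filter. Convergence in the product topology, a supremum of
   initial topologies, is tested one coordinate at a time, and convergence of this filter is the
   claim. *)
pose F : set_system (prod_topology T) :=
  filter_from [set V : forall k, set (T k) | forall k, nbhs (x k) (V k)]
    (fun V => [set y | forall k, V k (y k)]).
have FF : Filter F.
  apply: filter_from_filter.
    by exists (fun=> setT) => k; exact: filterT.
  move=> V V' nV nV'; exists (fun k => V k `&` V' k).
    by move=> k; exact: filterI.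
  by move=> y VV; split => k; have [] := VV k.
suff : F --> x by move=> /(_ U (open_nbhs_nbhs (conj oU Ux))) [V nV VU]; exists V.
apply/cvg_sup => i A /=.
rewrite (@nbhsE (initial_topology (fun y : (forall i, T i) => y i))) => -[_ [[W oW <-] Wxi] WA].
(* A cylinder: only coordinate [i] is constrained. *)
exists (dfwith (fun k => [set: T k]) i W) => [k|y Vy].
  case: dfwithP => [|j ij]; last exact: filterT.
  exact: open_nbhs_nbhs.
by apply: WA; have := Vy i; rewrite dfwithin.
Qed.

(** Separable metric factors have countable bases, so an open set is a countable union of basic
    boxes. It is needed because the resampled point is measurable coordinate by coordinate, while
    [H] is Borel for the product topology. *)
Lemma borel_prod_sub (R : realType) : (forall k, polish R (T k)) ->
  @borel (prod_topology T) `<=` <<s borel_box >>.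
Proof.
move=> hT; apply: smallest_sub; first exact: smallest_sigma_algebra.
pose dist k := sval (cid (hT k).2).
have distP k := svalP (cid (hT k).2).
pose D k : set (T k) := s2val (cid2 (hT k).1).
have cD k : countable (D k) := s2valP (cid2 (hT k).1).
have dD k : dense (D k) := s2valP' (cid2 (hT k).1).
have injD k : exists f : T k -> nat, {in D k &, injective f}.
  by apply/countable_injP; exact: cD.
pose f k := sval (cid (injD k)).
have fP k : {in D k &, injective (f k)} := svalP (cid (injD k)).
have distxx k x : dist k x x = 0.
  by have [h _ _ _ _] := distP k; have [_ [_ e]] := h x x; exact: e.
have symD k x y : dist k x y = dist k y x.
  by have [_ h _ _ _] := distP k; exact: h.
have triD k x y w : dist k x w <= dist k x y + dist k y w.
  by have [_ _ h _ _] := distP k; exact: h.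
have nbhs_dist k (x : T k) V : nbhs x V <->
    exists2 e : R, 0 < e & [set y | dist k x y < e] `<=` V.
  by have [_ _ _ h _] := distP k; rewrite h.
pose r (m : nat) : R := m.+1%:R^-1.
have r0 m : 0 < r m by rewrite invr_gt0.
pose N k (p : nat * nat) : set (T k) :=
  [set y | exists a, [/\ D k a, f k a = p.1 & dist k a y < r p.2]].
have openN k p : open (N k p).
  rewrite openE => y [a [Da fa ay]]; apply/nbhs_dist.
  exists (r p.2 - dist k a y); first by rewrite subr_gt0.
  move=> w /= yw; exists a; split => //.
  apply: le_lt_trans (triD k a y w) _.
  by rewrite -ltrBrDl.
have baseN k (x : T k) V : nbhs x V -> exists2 p, N k p x & N k p `<=` V.
  move=> /nbhs_dist [e e0 eV].
  (* Twice the radius must fit into [e], since two points of the ball are compared through its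
     centre. *)
  have [m me] : exists m, r m + r m < e.
    have e2 : 0 < e / 2 by rewrite divr_gt0.
    have [m _ /(_ m (leqnn m)) h] := near_infty_natSinv_lt (PosNum e2).
    by exists m; rewrite [e]splitr ltrD.
  have [a [xa Da]] : [set y | dist k x y < r m]° `&` D k !=set0.
    apply: dD; last exact: open_interior.
    by exists x; apply/nbhs_dist; exists (r m).
  have {}xa : dist k x a < r m by exact: interior_subset xa.
  exists (f k a, m); first by exists a; rewrite symD.
  move=> y [b [Db /= fba by_]]; apply: eV => /=.
  have ab : b = a by apply: fP; rewrite ?inE.
  apply: le_lt_trans (triD k x a y) _; apply: lt_trans me.
  by rewrite -ab in xa *; exact: ltrD.
move=> U oU.
(* Finite functions into pairs of naturals form a countable type; [sel] replaces the boxes that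
   leave [U] by the empty set. *)
pose box (g : {ffun 'I_n -> nat * nat}) : set (prod_topology T) :=
  [set y | forall k, N k (g k) (y k)].
pose sel g := if asbool (box g `<=` U) then box g else set0.
have -> : U = \bigcup_g sel g.
  apply/seteqP; split => [x Ux|x [g _]]; last first.
    by rewrite /sel; case: asboolP => // gU; exact: gU.
  have [V nV VU] := open_prod_box oU Ux.
  have cg k : exists p, N k p (x k) /\ N k p `<=` V k.
    by have [p ? ?] := baseN k _ _ (nV k); exists p.
  pose g := [ffun k => sval (cid (cg k))].
  have gU : box g `<=` U.
    move=> y By; apply: VU => k; have := By k; rewrite ffunE.
    by have [_] := svalP (cid (cg k)); apply.
  exists g => //; rewrite /sel asboolT // => k; rewrite ffunE.
  by have [] := svalP (cid (cg k)).
apply: sigma_bigcup_count => g; rewrite /sel; case: asboolP => _; last first.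
  exact sigma_set0.
apply: sub_sigma_algebra; exists (fun k => N k (g k)) => // k.
by apply: sub_sigma_algebra; exact: openN.
Qed.

End product_borel.

(** * Bounded functions measurable for a given sigma-algebra *)

Section measurable_wrt_theory.
Context {R : realType} {X : choiceType} (x0 : X).
Variables (F : set (set X)) (sF : sigma_algebra setT F).
Implicit Types f g : X -> R.

Local Notation mwrt := (measurable_wrt F (measurable : set (set R))).

(* [X] is pointed through [x0], since measurable types are pointed. *)
Let PX : pointedType := HB.pack X (isPointed.Build X x0).
Let MX := g_sigma_algebraType (F : set (set PX)).

Let mE : (measurable : set (set MX)) = F.
Proof. exact: measurable_g_measurableTypeE. Qed.

Let mwrtP f : mwrt f <-> measurable_fun setT (f : MX -> R).
Proof.
split => [mf _ B mB|mf B mB]; first by rewrite setTI mE; exact: mf.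
by have := mf measurableT B mB; rewrite setTI mE.
Qed.

Lemma mwrt_cst (r : R) : mwrt (fun=> r).
Proof. by apply/mwrtP; exact: measurable_cst. Qed.

Lemma mwrtD f g : mwrt f -> mwrt g -> mwrt (fun x => f x + g x).
Proof. by move=> /mwrtP mf /mwrtP mg; apply/mwrtP; exact: measurable_funD. Qed.

Lemma mwrtM f g : mwrt f -> mwrt g -> mwrt (fun x => f x * g x).
Proof. by move=> /mwrtP mf /mwrtP mg; apply/mwrtP; exact: measurable_funM. Qed.

Lemma mwrt_comp (phi : R -> R) f :
  measurable_fun setT phi -> mwrt f -> mwrt (phi \o f).
Proof. by move=> mphi /mwrtP mf; apply/mwrtP; exact: measurableT_comp. Qed.

Lemma mwrt_indic (B : set X) : F B -> mwrt (\1_B).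
Proof.
move=> FB; apply/mwrtP; apply: (@measurable_indic _ MX).
by rewrite mE.
Qed.

Lemma mwrt_cvg (h : (X -> R)^nat) f : (forall m, mwrt (h m)) ->
  (forall x, h ^~ x @ \oo --> f x) -> mwrt f.
Proof.
move=> mh hf; apply/mwrtP; apply: (@measurable_fun_cvg _ MX R setT h).
  by move=> m; apply/mwrtP; exact: mh.
by move=> x _; exact: hf.
Qed.

Definition bounded_measurable f := mwrt f /\ exists K : R, forall x, `|f x| <= K.

Lemma bmf_cst r : bounded_measurable (fun=> r).
Proof. by split; [exact: mwrt_cst|exists `|r|]. Qed.

Lemma bmfD f g : bounded_measurable f -> bounded_measurable g -> bounded_measurable (fun x => f x + g x).
Proof.
move=> [mf [K fK]] [mg [L gL]]; split; first exact: mwrtD.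
by exists (K + L) => x; rewrite (le_trans (ler_normD _ _)) // lerD.
Qed.

Lemma bmfM f g : bounded_measurable f -> bounded_measurable g -> bounded_measurable (fun x => f x * g x).
Proof.
move=> [mf [K fK]] [mg [L gL]]; split; first exact: mwrtM.
by exists (K * L) => x; rewrite normrM ler_pM.
Qed.

Lemma bmfN f : bounded_measurable f -> bounded_measurable (fun x => - f x).
Proof.
move=> bf; have := bmfM (bmf_cst (-1)) bf.
by under eq_fun do rewrite mulN1r.
Qed.

Lemma bmf_sum (I : Type) (s : seq I) (P : pred I) (f : I -> X -> R) :
  (forall i, bounded_measurable (f i)) -> bounded_measurable (fun x => \sum_(i <- s | P i) f i x).
Proof.
move=> bf; elim: s => [|i s IHs].
  by under eq_fun do rewrite big_nil; exact: bmf_cst.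
under eq_fun do rewrite big_cons.
by case: (P i) => //; exact: bmfD.
Qed.

Lemma bmf_indic (B : set X) : F B -> bounded_measurable (\1_B).
Proof.
move=> FB; split; first exact: mwrt_indic.
by exists 1 => x; rewrite indicE; case: (_ \in _); rewrite ?normr1 ?normr0.
Qed.

End measurable_wrt_theory.

(** [S] is [e] times the number of positive multiples of [e] up to [y], capped at [N]: it rounds [y]
    down to the grid as long as [y] is below [N%:R * e]. *)
Lemma step_sum_bounds (R : realType) (e y : R) (N : nat) : 0 < e -> 0 <= y ->
  let S := \sum_(i < N) e * (i.+1%:R * e <= y)%R%:R in
  (N%:R * e <= y -> S = N%:R * e) /\ (y < N%:R * e -> S <= y < S + e).
Proof.
move=> e0 y0; elim: N => [|N [IH1 IH2]] S.
  by rewrite /S big_ord0 mul0r; split => //; rewrite ltNge y0.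
rewrite /S big_ord_recr /=; split => h.
  rewrite h mulr1 IH1 ?mulrSr ?mulrDl ?mul1r //.
  by apply: le_trans h; rewrite ler_pM2r // ler_nat.
rewrite (_ : (N.+1%:R * e <= y) = false) ?mulr0 ?addr0; last first.
  by apply/negbTE; rewrite -ltNge.
have [Ny|yN] := leP (N%:R * e) y; last exact: IH2.
by rewrite IH1 // Ny /= (lt_le_trans h) // mulrSr mulrDl mul1r.
Qed.

Lemma step_approx (R : realType) (X : Type) (F : set (set X)) (f : X -> R) (K e : R) :
  measurable_wrt F measurable f -> (forall x, `|f x| <= K) -> 0 < e ->
  exists N (A : 'I_N -> set X), (forall i, F (A i)) /\
    forall x, `|f x - (- K + \sum_i e * \1_(A i) x)| <= e.
Proof.
move=> mf fK e0.
(* The grid has to cover the range of [f + K], which lies in [0, 2K]. *)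
have [N KN] : exists N : nat, 2 * K < N%:R * e.
  exists (Num.truncn `|2 * K / e|).+1; rewrite -ltr_pdivrMr //.
  by rewrite (le_lt_trans (ler_norm _)) // truncnS_gt.
exists N, (fun i => f @^-1` `[i.+1%:R * e - K, +oo[%classic); split.
  by move=> i; apply: mf; exact: measurable_itv.
move=> x; have /andP[fl fr] : - K <= f x <= K by rewrite -ler_norml.
have y0 : 0 <= f x + K by rewrite -lerBlDr sub0r.
have [_] := step_sum_bounds N e0 y0.
have -> : \sum_(i < N) e * (i.+1%:R * e <= f x + K)%R%:R =
  \sum_(i < N) e * \1_(f @^-1` `[i.+1%:R * e - K, +oo[%classic) x.
  apply: eq_bigr => i _; rewrite indicE; congr (_ * _).
  congr (_%:R).
  congr nat_of_bool; apply/idP/idP => h.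
    by rewrite inE /= in_itv /= andbT lerBlDr.
  by move: h; rewrite inE /= in_itv /= andbT lerBlDr.
have yN : f x + K < N%:R * e by apply: le_lt_trans KN; lra.
move=> /(_ yN) /andP[h1 h2]; rewrite ler_norml; apply/andP; split; lra.
Qed.

(** * Expectation *)

Section expectation.
Context disp (W : measurableType disp) (R : realType) (P : probability W R).
Implicit Types (Y Z h : W -> R) (D : set W).

Definition Ex Y : R := Rintegral P setT Y.
Definition integ Y : Prop := P.-integrable setT (EFin \o Y).

Local Notation bm := (@bounded_measurable R W measurable).

Lemma bm_cst r : bm (fun=> r).
Proof. by apply: bmf_cst; [exact: point|exact: sigma_algebra_measurable]. Qed.

Lemma bmD h h' : bm h -> bm h' -> bm (fun w => h w + h' w).
Proof. by apply: bmfD; [exact: point|exact: sigma_algebra_measurable]. Qed.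

Lemma bmM h h' : bm h -> bm h' -> bm (fun w => h w * h' w).
Proof. by apply: bmfM; [exact: point|exact: sigma_algebra_measurable]. Qed.

Lemma bm_sum (I : Type) (s : seq I) (Q : pred I) (f : I -> W -> R) :
  (forall i, bm (f i)) -> bm (fun w => \sum_(i <- s | Q i) f i w).
Proof. by apply: bmf_sum; [exact: point|exact: sigma_algebra_measurable]. Qed.

Lemma bm_indic D : measurable D -> bm (\1_D).
Proof.
by apply: bmf_indic; [exact: point|exact: sigma_algebra_measurable].
Qed.

Lemma bm_measurable h : bm h -> measurable_fun setT h.
Proof. by move=> [mh _] _ B mB; rewrite setTI; exact: mh. Qed.

Lemma bm_bounded h : bm h -> [bounded h x | x in setT].
Proof.
move=> [_ [K hK]]; exists K; split; first exact: num_real.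
by move=> M KM x _; exact: le_trans (hK x) (ltW KM).
Qed.

Lemma integ_bm h : bm h -> integ h.
Proof.
move=> bh; apply: measurable_bounded_integrable => //.
- by apply: le_lt_trans (probability_le1 P measurableT) _; rewrite ltry.
- exact: bm_measurable.
- exact: bm_bounded.
Qed.

Lemma integM h Y : bm h -> integ Y -> integ (fun w => h w * Y w).
Proof.
move=> bh iY; apply: (@integrableMr _ W R P setT _ h (EFin \o Y)) => //.
- exact: bm_measurable.
- exact: bm_bounded.
Qed.

Lemma integD Y Z : integ Y -> integ Z -> integ (fun w => Y w + Z w).
Proof. by move=> iY iZ; exact: (integrableD measurableT iY iZ). Qed.

Lemma integZ r Y : integ Y -> integ (fun w => r * Y w).
Proof. by move=> iY; exact: (integrableZl measurableT r iY). Qed.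

Lemma integN Y : integ Y -> integ (fun w => - Y w).
Proof. by move=> iY; exact: (integrableN iY). Qed.

Lemma integB Y Z : integ Y -> integ Z -> integ (fun w => Y w - Z w).
Proof. by move=> iY iZ; apply: integD => //; exact: integN. Qed.

Lemma integ_norm Y : integ Y -> integ (fun w => `|Y w|).
Proof. by move=> iY; exact: (integrable_abse iY). Qed.

Lemma integ_sum (I : Type) (s : seq I) (Q : pred I) (Y : I -> W -> R) :
  (forall i, integ (Y i)) -> integ (fun w => \sum_(i <- s | Q i) Y i w).
Proof.
move=> iY; elim: s => [|i s IHs].
  under eq_fun do rewrite big_nil.
  exact/integ_bm/bm_cst.
under eq_fun do rewrite big_cons.
by case: (Q i) => //; exact: integD.
Qed.

Lemma ExD Y Z : integ Y -> integ Z -> Ex (fun w => Y w + Z w) = Ex Y + Ex Z.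
Proof. by move=> iY iZ; exact: RintegralD. Qed.

Lemma ExZ r Y : integ Y -> Ex (fun w => r * Y w) = r * Ex Y.
Proof. by move=> iY; exact: RintegralZl. Qed.

Lemma ExB Y Z : integ Y -> integ Z -> Ex (fun w => Y w - Z w) = Ex Y - Ex Z.
Proof. by move=> iY iZ; exact: RintegralB. Qed.

Lemma Ex_cst r : Ex (fun=> r) = r.
Proof.
rewrite /Ex Rintegral_cst // [X in fine X](_ : _ = 1%E) ?mulr1 //.
exact: probability_setT.
Qed.

Lemma Ex_sum (I : Type) (s : seq I) (Q : pred I) (Y : I -> W -> R) :
  (forall i, integ (Y i)) ->
  Ex (fun w => \sum_(i <- s | Q i) Y i w) = \sum_(i <- s | Q i) Ex (Y i).
Proof.
move=> iY; elim: s => [|i s IHs].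
  by rewrite big_nil; under eq_fun do rewrite big_nil; exact: Ex_cst.
rewrite big_cons; under eq_fun do rewrite big_cons.
by case: (Q i) => //; rewrite ExD ?IHs //; exact: integ_sum.
Qed.

Lemma Ex_le Y Z : integ Y -> integ Z -> (forall w, Y w <= Z w) -> Ex Y <= Ex Z.
Proof. by move=> iY iZ YZ; exact: le_Rintegral. Qed.

Lemma Ex_ae_eq Y Z : integ Y -> integ Z -> {ae P, forall w, Y w = Z w} ->
  Ex Y = Ex Z.
Proof.
move=> iY iZ YZ; rewrite /Ex /Rintegral; congr fine.
apply: ae_eq_integral => //.
- by have /integrableP[] := iY.
- by have /integrableP[] := iZ.
- by move: YZ; apply: filterS => w YZ _ /=; rewrite YZ.
Qed.

(** Replacing [Z] by the almost surely equal [max Y Z] makes the inequality hold everywhere. *)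
Lemma Ex_ae_le Y Z : integ Y -> integ Z -> {ae P, forall w, Y w <= Z w} ->
  Ex Y <= Ex Z.
Proof.
move=> iY iZ YZ.
have -> : Ex Z = Ex (fun w => Num.max (Y w) (Z w)).
  apply: Ex_ae_eq => //; last first.
    by move: YZ; apply: filterS => w YZ; rewrite (max_idPr YZ).
  have -> : (fun w => Num.max (Y w) (Z w)) =
            (fun w => 2^-1 * (Y w + Z w + `|Y w - Z w|)).
    by apply/funext => w; rewrite mulrC -maxr_absE.
  by apply/integZ/integD; [exact: integD|exact/integ_norm/integB].
apply: Ex_le => //; last by move=> w; rewrite le_max lexx.
have -> : (fun w => Num.max (Y w) (Z w)) =
          (fun w => 2^-1 * (Y w + Z w + `|Y w - Z w|)).
  by apply/funext => w; rewrite mulrC -maxr_absE.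
by apply/integZ/integD; [exact: integD|exact/integ_norm/integB].
Qed.

Lemma Ex_norm_le Y : integ Y -> `|Ex Y| <= Ex (fun w => `|Y w|).
Proof. by move=> iY; exact: le_normr_Rintegral. Qed.

Lemma setint_Ex D Y : measurable D -> integ Y ->
  (\int[P]_(w in D) (Y w)%:E = (Ex (fun w => \1_D w * Y w))%:E)%E.
Proof.
move=> mD iY.
have -> : Ex (fun w => \1_D w * Y w) = Rintegral P D Y.
  rewrite /Ex [RHS]Rintegral_mkcond patch_indic.
  by apply: eq_Rintegral => w _; rewrite mulrC.
rewrite fineK //; apply: integrable_fin_num => //.
by apply: (integrableS measurableT).
Qed.

Section transfer.
Context {X : choiceType}.
Variables (F : set (set X)) (u v : W -> X) (Y Z : W -> R).
Hypotheses (iY : integ Y) (iZ : integ Z).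

Definition indic_eq (A : set X) :=
  Ex (fun w => \1_A (u w) * Y w) = Ex (fun w => \1_A (v w) * Z w).

(** Step functions approximate [f] uniformly, so the error is at most their distance times the first
    absolute moment of the weight; the weights need only be integrable. *)
Lemma Ex_transfer (f : X -> R) :
  (forall A, F A -> measurable (u @^-1` A)) ->
  (forall A, F A -> measurable (v @^-1` A)) ->
  F setT -> (forall A, F A -> indic_eq A) -> bounded_measurable F f ->
  Ex (fun w => f (u w) * Y w) = Ex (fun w => f (v w) * Z w).
Proof.
move=> mu mv FT FE [mf [K fK]].
have bmu (A : set X) : F A -> bm (fun w => \1_A (u w)).
  by move=> /mu mA; exact: (bm_indic mA).
have bmv (A : set X) : F A -> bm (fun w => \1_A (v w)).
  by move=> /mv mA; exact: (bm_indic mA).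
have bf (t : W -> X) : (forall A, F A -> measurable (t @^-1` A)) ->
    bm (fun w => f (t w)).
  by move=> mt; split; [move=> B mB; exact: mt _ (mf _ mB)|exists K].
suff small e : 0 < e -> `|Ex (fun w => f (u w) * Y w) - Ex (fun w => f (v w) * Z w)|
    <= e * (Ex (fun w => `|Y w|) + Ex (fun w => `|Z w|)).
  apply/eqP; rewrite -subr_eq0 -normr_le0; apply/ler_addgt0Pl => e e0.
  rewrite addr0; set S := Ex _ + Ex _ in small.
  have S0 : 0 <= S.
    by apply: addr_ge0; apply: Rintegral_ge0.
  (* The [+ 1] keeps the divisor positive when both weights vanish almost surely. *)
  apply: le_trans (small (e / (S + 1)) _) _; first by rewrite divr_gt0 // ltr_wpDl.
  have S1 : S / (S + 1) <= 1 by rewrite ler_pdivrMr ?ltr_wpDl // mul1r lerDl.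
  by rewrite mulrAC -mulrA ler_piMr // ltW.
move=> e0; have [N [A [FA fA]]] := step_approx mf fK e0.
pose s x := - K + \sum_i e * \1_(A i) x.
have bsu : bm (fun w => s (u w)).
  apply: bmD; first exact: bm_cst.
  by apply: bm_sum => i; apply: bmM; [exact: bm_cst|exact: bmu].
have bsv : bm (fun w => s (v w)).
  apply: bmD; first exact: bm_cst.
  by apply: bm_sum => i; apply: bmM; [exact: bm_cst|exact: bmv].
have sE (t : W -> X) (Y' : W -> R) : integ Y' ->
    (forall i, bm (fun w => \1_(A i) (t w))) ->
    Ex (fun w => s (t w) * Y' w) =
    - K * Ex Y' + \sum_i e * Ex (fun w => \1_(A i) (t w) * Y' w).
  move=> iY' bA.
  have -> : (fun w => s (t w) * Y' w) =
     (fun w => - K * Y' w + \sum_i e * (\1_(A i) (t w) * Y' w)).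
    apply/funext => w; rewrite /s mulrDl mulr_suml; congr (_ + _).
    by apply: eq_bigr => i _; rewrite mulrA.
  have iA i : integ (fun w => \1_(A i) (t w) * Y' w) by exact: integM.
  rewrite ExD ?ExZ //; [|exact: integZ|by apply: integ_sum => i; exact: integZ].
  by rewrite Ex_sum => [|i]; [under eq_bigr do rewrite ExZ //|exact: integZ].
have sYZ : Ex (fun w => s (u w) * Y w) = Ex (fun w => s (v w) * Z w).
  rewrite (sE u Y iY (fun i => bmu _ (FA i))) (sE v Z iZ (fun i => bmv _ (FA i))).
  congr (_ * _ + _).
    have := FE _ FT; rewrite /indic_eq.
    by rewrite !indicT; under eq_fun do rewrite mul1r; under [in RHS]eq_fun do rewrite mul1r.
  by apply: eq_bigr => i _; rewrite FE.
have close (t : W -> X) (Y' : W -> R) : integ Y' -> bm (fun w => f (t w)) ->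
    bm (fun w => s (t w)) ->
    `|Ex (fun w => f (t w) * Y' w) - Ex (fun w => s (t w) * Y' w)| <=
    e * Ex (fun w => `|Y' w|).
  move=> iY' bft bst; rewrite -ExB; try exact: integM.
  rewrite -ExZ; last exact: integ_norm.
  apply: le_trans (Ex_norm_le _) _; first by apply: integB; exact: integM.
  apply: Ex_le; first by apply/integ_norm/integB; exact: integM.
    exact/integZ/integ_norm.
  by move=> w; rewrite -mulrBl normrM ler_wpM2r.
have := close u Y iY (bf u mu) bsu; have := close v Z iZ (bf v mv) bsv.
rewrite sYZ mulrDr => h1 h2; apply: le_trans (ler_distD _ _ _) _.
by apply: lerD; [exact: h2|rewrite distrC; exact: h1].
Qed.



End transfer.
End expectation.

(** * Conditional expectations *)

Section pi_lambda.
Context disp (W : measurableType disp) (R : realType) (P : probability W R).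
Context {X : Type}.
Variables (G : set (set X)) (u v : W -> X) (Y Z : W -> R).

(** The sets on which the two signed measures agree form a Dynkin system: equal total masses give
    complements, countable additivity gives disjoint unions. *)
Lemma Ex_pi_lambda : setI_closed G ->
  (forall A, <<s G >> A -> measurable (u @^-1` A)) ->
  (forall A, <<s G >> A -> measurable (v @^-1` A)) ->
  integ P Y -> integ P Z -> Ex P Y = Ex P Z ->
  (forall A, G A -> Ex P (fun w => \1_A (u w) * Y w) =
                    Ex P (fun w => \1_A (v w) * Z w)) ->
  forall A, <<s G >> A -> Ex P (fun w => \1_A (u w) * Y w) =
                          Ex P (fun w => \1_A (v w) * Z w).
Proof.
move=> GI mu mv iY iZ YZ GE A sA.
have imul (t : W -> X) (Y' : W -> R) B : measurable (t @^-1` B) -> integ P Y' ->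
    integ P (fun w => \1_B (t w) * Y' w).
  by move=> mB iY'; exact: (integM (bm_indic _ mB) iY').
pose Q := [set B | <<s G >> B /\ Ex P (fun w => \1_B (u w) * Y w) =
                                 Ex P (fun w => \1_B (v w) * Z w)].
suff : <<s G >> `<=` Q by move=> /(_ A sA) [].
rewrite -setI_closed_g_dynkin_g_sigma_algebra //; apply: smallest_sub; last first.
  by move=> B GB; split; [exact: sub_sigma_algebra|exact: GE].
split.
- split; first exact: sigma_setT.
  by rewrite indicT; under eq_fun do rewrite mul1r;
    under [in RHS]eq_fun do rewrite mul1r.
- move=> B [sB EB]; split; first exact: sigma_compl.
  have EC (t : W -> X) (Y' : W -> R) : measurable (t @^-1` B) -> integ P Y' ->
      Ex P (fun w => \1_(~` B) (t w) * Y' w) =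
      Ex P Y' - Ex P (fun w => \1_B (t w) * Y' w).
    move=> mB iY'; rewrite -ExB //; last exact: imul.
    congr Ex; apply/funext => w; rewrite indicC /=.
    by rewrite indicE; case: (_ \in _) => /=; lra.
  rewrite !EC ?EB ?YZ //; [exact: mv|exact: mu].
- move=> F tF QF; split.
    by apply: sigma_algebra_bigcup => k; have [] := QF k.
  have EU (t : W -> X) (Y' : W -> R) :
      (forall B, <<s G >> B -> measurable (t @^-1` B)) -> integ P Y' ->
      ((Ex P (fun w => \1_(\bigcup_k F k) (t w) * Y' w))%:E =
      \sum_(0 <= k <oo) (Ex P (fun w => \1_(F k) (t w) * Y' w))%:E)%E.
    move=> mt iY'.
    have mF k : measurable (t @^-1` F k) by apply: mt; have [] := QF k.
    rewrite -(setint_Ex (D := t @^-1` \bigcup_k F k)) //; last first.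
      by rewrite preimage_bigcup; exact: bigcup_measurable.
    rewrite preimage_bigcup integral_bigcup //.
    + by apply: eq_eseriesr => k _; exact: (setint_Ex (mF k) iY').
    + move=> i j _ _ [w [/= Fi Fj]]; apply: tF => //.
      by exists (t w).
    + by apply: (integrableS measurableT) => //; exact: bigcup_measurable.
  apply: EFin_inj; rewrite !EU //.
  by apply: eq_eseriesr => k _; have [_ ->] := QF k.
Qed.

End pi_lambda.

Section conditional.
Context disp (W : measurableType disp) (R : realType) (P : probability W R).
Variable G : set (set W).
Hypotheses (sG : sigma_algebra setT G) (Gm : G `<=` measurable).
Implicit Types (X Y h : W -> R).

Local Notation bm := (@bounded_measurable R W measurable).
Local Notation bG := (@bounded_measurable R W G).

Lemma bG_bm h : bG h -> bm h.
Proof. by move=> [mh hK]; split => // B mB; exact/Gm/mh. Qed.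

Let GT : G setT.
Proof. by have [G0 GC _] := sG; have := GC _ G0; rewrite setD0. Qed.

Lemma cond_expP X Y : is_cond_exp P G X Y <->
  [/\ integ P X, integ P Y, measurable_wrt G measurable Y &
      forall A, G A -> Ex P (fun w => \1_A w * Y w) = Ex P (fun w => \1_A w * X w)].
Proof.
split=> [[iX iY mY E]|[iX iY mY E]]; split => // A GA; have mA := Gm GA.
  by apply: EFin_inj; rewrite -!setint_Ex //; exact: E.
by rewrite !(setint_Ex mA) // E.
Qed.

Lemma cond_exp_test X Y h : is_cond_exp P G X Y -> bG h ->
  Ex P (fun w => h w * X w) = Ex P (fun w => h w * Y w).
Proof.
move=> /cond_expP [iX iY mY E] bh.
apply: (@Ex_transfer _ W R P W G id id X Y iX iY h) => //.
by move=> A GA; rewrite /indic_eq E.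
Qed.

Lemma cond_exp_affine a r X Y : is_cond_exp P G X Y ->
  is_cond_exp P G (fun w => a + r * X w) (fun w => a + r * Y w).
Proof.
move=> /cond_expP [iX iY mY E]; apply/cond_expP.
have ic : integ P (fun=> a) by exact/integ_bm/bm_cst.
split; [exact/integD/integZ|exact/integD/integZ| |].
  by apply: mwrtD => //; [exact: point|exact: mwrt_cst point _ _ _|
    apply: mwrtM => //; [exact: point|exact: mwrt_cst point _ _ _]].
move=> A GA; have bA := bm_indic R (Gm GA).
have split_ Z : integ P Z -> Ex P (fun w => \1_A w * (a + r * Z w)) =
    Ex P (fun w => \1_A w * a) + r * Ex P (fun w => \1_A w * Z w).
  move=> iZ; have iAZ := integM bA iZ; rewrite -ExZ // -ExD; last exact: integZ.
    by congr Ex; apply/funext => w; ring.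
  exact: integM.
by rewrite !split_ // E.
Qed.

(** Test on the event [N] where [Y] is negative: the integrand there is nonpositive, yet its
    expectation equals that of [X] on [N], so it vanishes almost surely. *)
Lemma cond_exp_ge0 X Y : is_cond_exp P G X Y -> (forall w, 0 <= X w) ->
  {ae P, forall w, 0 <= Y w}.
Proof.
move=> /cond_expP [iX iY mY E] X0.
pose N := Y @^-1` `]-oo, 0[%classic.
have GN : G N by apply: mY; exact: measurable_itv.
have bN := bm_indic R (Gm GN).
pose f w := \1_N w * Y w.
have fle0 w : f w <= 0.
  rewrite /f indicE; case: (boolP (w \in N)) => [|_]; last by rewrite mul0r.
  by rewrite inE /N /= in_itv /= mul1r => /ltW.
have if_ : integ P f by exact: integM.
have Ef0 : Ex P f = 0.
  apply/eqP; rewrite eq_le; apply/andP; split.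
    by rewrite -(Ex_cst P 0); apply: Ex_le => //; exact/integ_bm/bm_cst.
  rewrite /f E // -(Ex_cst P 0); apply: Ex_le.
  - exact/integ_bm/bm_cst.
  - exact: integM.
  - by move=> w; rewrite mulr_ge0.
have : (\int[P]_(w in setT) `|(f w)%:E| = 0)%E.
  have -> : (fun w => `|(f w)%:E|%E) = (fun w => (- f w)%:E).
    by apply/funext => w; rewrite abse_EFin ler0_norm.
  have := setint_Ex measurableT (integN if_); rewrite indicT => ->.
  under eq_fun do rewrite mul1r -mulN1r.
  by rewrite ExZ // Ef0 mulr0.
have mf : measurable_fun setT (EFin \o f) by have /integrableP[] := if_.
move=> /(ae_eq_integral_abs P measurableT mf); apply: filterS => w /(_ I) /= [].
rewrite /f indicE; case: (boolP (w \in N)) => [wN|]; last first.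
  by rewrite notin_setE /N /= in_itv /= => /negP; rewrite -leNgt.
by rewrite mul1r => ->.
Qed.

(** Truncation to [a, b] alters [Y] only on a null set and gives a version bounded everywhere, hence
    usable as a test function. *)
Lemma cond_exp_clip a b X Y : is_cond_exp P G X Y -> (forall w, a <= X w <= b) ->
  exists Y', bG Y' /\ {ae P, forall w, Y' w = Y w}.
Proof.
move=> cXY Xab; exists (fun w => Num.max a (Num.min b (Y w))); split.
  split.
    apply: (@mwrt_comp R W point G sG (fun y => Num.max a (Num.min b y))).
      apply: measurable_maxr => //; apply: measurable_minr => //.
    by have [] := cXY.
  exists (`|a| + `|b|) => w; have := normr_ge0 a; have := normr_ge0 b.
  have := ler_norm a; have := ler_norm b; have := lerNnormlW (x := b) (lexx _).
  have := lerNnormlW (x := a) (lexx _); rewrite ler_norml /Order.max /Order.min.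
  case: (ltP b (Y w)) => h1; case: ltP => h2 *; apply/andP; split; lra.
have aY : {ae P, forall w, 0 <= - a + 1 * Y w}.
  apply: cond_exp_ge0 (cond_exp_affine (- a) 1 cXY) _ => w.
  by have /andP[] := Xab w; rewrite mul1r addrC subr_ge0.
have bY : {ae P, forall w, 0 <= b + -1 * Y w}.
  apply: cond_exp_ge0 (cond_exp_affine b (- 1) cXY) _ => w.
  by have /andP[] := Xab w; rewrite mulN1r subr_ge0.
apply: filterS2 aY bY => w; rewrite mul1r mulN1r addrC !subr_ge0 => h1 h2.
by rewrite (min_idPr h2) (max_idPr h1).
Qed.

Lemma cond_exp_ae_test X Y Y' h : is_cond_exp P G X Y -> bG Y' ->
  {ae P, forall w, Y' w = Y w} -> bG h ->
  Ex P (fun w => h w * X w) = Ex P (fun w => h w * Y' w).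
Proof.
move=> cXY bY' YY' bh; rewrite (cond_exp_test cXY bh).
have /cond_expP [_ iY _ _] := cXY; have bh' := bG_bm bh.
apply: Ex_ae_eq; [exact: integM| |].
- by apply: integM => //; exact/integ_bm/bG_bm.
- by apply: filterS YY' => w ->.
Qed.

Lemma cond_prob_version B q : is_cond_prob P G B q ->
  exists p, [/\ bG p, {ae P, forall w, p w = q w} & forall h, bG h ->
    Ex P (fun w => h w * \1_B w) = Ex P (fun w => h w * p w)].
Proof.
move=> cq; have := @cond_exp_clip 0 1 _ _ cq.
case=> [w|p [bp pq]]; first by rewrite indicE; case: (_ \in _); rewrite lexx ler01.
by exists p; split => // h bh; exact: cond_exp_ae_test cq _ _ _.
Qed.

(* [p B] is a version of both conditional probabilities of [B] that lies in
   [[0, 1]] everywhere, so that products of such versions remain test functions. *)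
Lemma cond_iid_kernel (T : topologicalType) (X Y : W -> T) :
  measurable_wrt measurable (@borel T) X ->
  measurable_wrt measurable (@borel T) Y -> cond_iid P G X Y ->
  exists p : set T -> W -> R,
  (forall B, borel B -> bG (p B)) /\
  (forall B h, borel B -> bG h ->
    Ex P (fun w => h w * \1_B (X w)) = Ex P (fun w => h w * p B w) /\
    Ex P (fun w => h w * \1_B (Y w)) = Ex P (fun w => h w * p B w)) /\
  (forall B C h, borel B -> borel C -> bG h ->
    Ex P (fun w => h w * (\1_B (X w) * \1_C (Y w))) =
    Ex P (fun w => h w * (p B w * p C w))).
Proof.
move=> mX mY [ind idd].
have bGM h h' : bG h -> bG h' -> bG (fun w => h w * h' w).
  by apply: bmfM => //; exact: point.
have [p hp] : exists p : set T -> W -> R, forall B, borel B -> bG (p B) /\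
    forall h, bG h -> Ex P (fun w => h w * \1_B (X w)) = Ex P (fun w => h w * p B w) /\
    Ex P (fun w => h w * \1_B (Y w)) = Ex P (fun w => h w * p B w).
  suff ex B : exists pB, borel B -> bG pB /\ forall h, bG h ->
      Ex P (fun w => h w * \1_B (X w)) = Ex P (fun w => h w * pB w) /\
      Ex P (fun w => h w * \1_B (Y w)) = Ex P (fun w => h w * pB w).
    by exists (fun B => sval (cid (ex B))) => B; exact: svalP (cid (ex B)).
  (* A kernel is chosen for every set, with default 0 outside the Borel sets. *)
  have [bB|nB] := pselect (borel B); last by exists (fun=> 0) => /nB.
  have [q qX qY] := idd _ bB; have [pB [bpB pq hX]] := cond_prob_version qX.
  exists pB => _; split=> // h bh; split; first exact: hX.
  exact: (cond_exp_ae_test qY bpB pq bh).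
exists p; split; first by move=> B /hp [].
split; first by move=> B h /hp [_]; exact.
move=> B C h bB bC bh.
have [bpB hB] := hp _ bB; have [bpC hC] := hp _ bC.
have [q [r [cq cr cqr]]] := ind _ _ bB bC.
have [q' [bq' qq' hq']] := cond_prob_version cq.
have [r' [br' rr' hr']] := cond_prob_version cr.
(* Independence supplies its own versions [q'] and [r']. They are traded for [p B] and [p C] one at
   a time, the other factor being absorbed into the test function. *)
transitivity (Ex P (fun w => h w * (q' w * r' w))).
  rewrite -(cond_exp_ae_test cqr (bGM _ _ bq' br') _ bh).
    by congr Ex; apply/funext => w; rewrite indicI.
  by apply: filterS2 qq' rr' => w -> ->.
have e1 : (fun w => h w * (q' w * r' w)) = (fun w => h w * r' w * q' w).
  by apply/funext => w; ring.
have e2 : (fun w => h w * r' w * p B w) = (fun w => h w * p B w * r' w).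
  by apply/funext => w; ring.
have e3 : (fun w => h w * p B w * p C w) = (fun w => h w * (p B w * p C w)).
  by apply/funext => w; ring.
rewrite e1 -hq'; last exact: bGM.
rewrite (hB _ (bGM _ _ bh br')).1 e2 -hr'; last exact: bGM.
by rewrite (hC _ (bGM _ _ bh bpB)).2 e3.
Qed.

End conditional.

(** * Resampling one coordinate *)

Lemma measurable_wrt_generated (X Y : Type) (F : set (set X)) (G : set (set Y))
    (f : X -> Y) : sigma_algebra setT F -> (forall A, G A -> F (f @^-1` A)) ->
  measurable_wrt F <<s G >> f.
Proof.
move=> [F0 FC FU] FG; suff : <<s G >> `<=` [set A | F (f @^-1` A)] by [].
apply: smallest_sub => //; split => [|A FA|A FA] /=.
- by rewrite preimage_set0.
- by rewrite setTD preimage_setC -setTD; exact: FC.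
- by rewrite preimage_bigcup; exact: FU.
Qed.

Section resampling.
Context disp (W : measurableType disp) (R : realType) (P : probability W R).
Context {n : nat} {T : 'I_n -> topologicalType}.
Variables (z : W -> prod_topology T).
Hypothesis mz : measurable_wrt measurable (@borel (prod_topology T)) z.

Local Notation BS := <<s @borel_box n T >>.

Lemma measurable_coord j : measurable_wrt measurable (@borel (T j)) (fun w => z w j).
Proof.
apply: measurable_wrt_generated; first exact: sigma_algebra_measurable.
move=> A oA; rewrite (_ : _ @^-1` A = z @^-1` (proj j @^-1` A)) //.
apply: mz; apply: sub_sigma_algebra.
have /continuousP oc : continuous (proj j : prod_topology T -> T j).
  exact: (@proj_continuous _ T j).
exact: oc.
Qed.

Lemma measurable_boxes (y : W -> prod_topology T) :
  (forall j, measurable_wrt measurable (@borel (T j)) (fun w => y w j)) ->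
  measurable_wrt measurable BS y.
Proof.
move=> my; apply: measurable_wrt_generated; first exact: sigma_algebra_measurable.
move=> _ [C bC ->].
have -> : y @^-1` [set x | forall j, C j (x j)] =
   \bigcap_(j in [set: 'I_n]) ((fun w => y w j) @^-1` C j).
  by apply/seteqP; split => [w Cw j _|w Cw j]; [exact: Cw|exact: (Cw j I)].
apply: fin_bigcap_measurable => // j _; exact: my (bC j).
Qed.

Lemma Ex_box (u v : W -> prod_topology T) (Y Z : W -> R)
    (f : prod_topology T -> R) :
  measurable_wrt measurable BS u -> measurable_wrt measurable BS v ->
  integ P Y -> integ P Z ->
  (forall C : forall j, set (T j), (forall j, borel (C j)) ->
     Ex P (fun w => \1_[set x : prod_topology T | forall j, C j (x j)] (u w) * Y w) =
     Ex P (fun w => \1_[set x : prod_topology T | forall j, C j (x j)] (v w) * Z w)) ->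
  bounded_measurable BS f -> Ex P (fun w => f (u w) * Y w) = Ex P (fun w => f (v w) * Z w).
Proof.
move=> mu mv iY iZ EC bf; apply: Ex_transfer (bf) => //; first exact: sigma_setT.
apply: Ex_pi_lambda => //; first exact: borel_box_setI.
  have := EC (fun=> setT) (fun=> sigma_setT).
  rewrite (_ : [set x | _] = setT) ?indicT; last by apply/seteqP; split.
  by under eq_fun do rewrite mul1r; under [in RHS]eq_fun do rewrite mul1r.
by move=> _ [C bC ->]; exact: EC.
Qed.

Variables (k : 'I_n) (zk : W -> T k).
Hypothesis mzk : measurable_wrt measurable (@borel (T k)) zk.
Hypothesis ciid : cond_iid P (sigma_except z k) zk (fun w => z w k).

Definition resample w : prod_topology T := dfwith (z w) k (zk w).

Let mzB : measurable_wrt measurable BS z.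
Proof. by apply: measurable_boxes => j; exact: measurable_coord. Qed.

Lemma measurable_resample : measurable_wrt measurable BS resample.
Proof.
apply: measurable_boxes => j; rewrite /resample.
have [->|jk] := eqVneq j k.
  by rewrite (_ : (fun w => _) = zk) //; apply/funext => w; rewrite dfwithin.
rewrite (_ : (fun w => _) = (fun w => z w j)); first exact: measurable_coord.
by apply/funext => w; rewrite dfwithout // eq_sym.
Qed.

Lemma sigma_except_measurable : sigma_except z k `<=` measurable.
Proof.
apply: smallest_sub; first exact: sigma_algebra_measurable.
by move=> A [j _ [B bB <-]]; rewrite setTI; exact: measurable_coord.
Qed.

Let sG : sigma_algebra setT (sigma_except z k).
Proof. exact: smallest_sigma_algebra. Qed.

Local Notation bG := (@bounded_measurable R W (sigma_except z k)).

(* The part of a box event that does not involve the [k]-th coordinate. *)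
Definition rest (C : forall j, set (T j)) : set W :=
  [set w | forall j, j != k -> C j (z w j)].

Lemma sigma_except_rest C : (forall j, borel (C j)) -> sigma_except z k (rest C).
Proof.
move=> bC.
suff h j : sigma_except z k [set w | j != k -> C j (z w j)].
  by have := sigma_forall h.
have [->|jk] := eqVneq j k.
  rewrite (_ : [set w | _] = setT); first exact sigma_setT.
  by apply/seteqP; split.
apply: sub_sigma_algebra; exists j => //; exists (C j) => //.
by rewrite setTI; apply/seteqP; split => [w ? _|w /(_ isT)].
Qed.

Lemma indic_andb (X : Type) (A B D : set X) (x : X) : (A x <-> B x /\ D x) ->
  \1_A x = \1_B x * \1_D x :> R.
Proof.
move=> ABD; rewrite !indicE -natrM mulnb; congr (_%:R); congr nat_of_bool.
apply/idP/idP => [|/andP[]]; rewrite !inE; first by move/ABD => [? ?]; apply/andP; rewrite !inE.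
by move=> ? ?; apply/ABD.
Qed.

Lemma indic_box_z C w : \1_[set x : prod_topology T | forall j, C j (x j)] (z w) =
  \1_(rest C) w * \1_(C k) (z w k) :> R.
Proof.
have := @indic_andb W (z @^-1` [set x : prod_topology T | forall j, C j (x j)])
  (rest C) ((fun w => z w k) @^-1` C k) w; apply.
split => [Cz|[rC Ck] j]; first by split => // j _.
by have [->|jk] := eqVneq j k; [exact: Ck|exact: rC].
Qed.

Lemma indic_box_resample C w :
  \1_[set x : prod_topology T | forall j, C j (x j)] (resample w) =
  \1_(rest C) w * \1_(C k) (zk w) :> R.
Proof.
have := @indic_andb W (resample @^-1` [set x : prod_topology T | forall j, C j (x j)])
  (rest C) (zk @^-1` C k) w; apply.
split => [Cz|[rC Ck] j] /=.
  split => [j jk|]; first by have := Cz j; rewrite /resample dfwithout // eq_sym.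
  by have := Cz k; rewrite /resample dfwithin.
rewrite /resample; have [->|jk] := eqVneq j k; first by rewrite dfwithin.
by rewrite dfwithout; [exact: rC|rewrite eq_sym].
Qed.

Let kernel := cond_iid_kernel sG sigma_except_measurable mzk (@measurable_coord k) ciid.

Lemma bG_rest C : (forall j, borel (C j)) -> bG (\1_(rest C)).
Proof. by move=> bC; apply: bmf_indic => //; [exact: point|exact: sigma_except_rest]. Qed.

Let bGM h h' : bG h -> bG h' -> bG (fun w => h w * h' w).
Proof. by apply: bmfM => //; exact: point. Qed.

Lemma bm_comp (u : W -> prod_topology T) f :
  measurable_wrt measurable BS u -> bounded_measurable BS f -> @bounded_measurable R W measurable (fun w => f (u w)).
Proof.
by move=> mu [mf [K fK]]; split; [move=> B mB; exact: mu _ (mf _ mB)|exists K].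
Qed.

Let bbox C : (forall j, borel (C j)) ->
  @bounded_measurable R _ BS (\1_[set x : prod_topology T | forall j, C j (x j)]).
Proof.
move=> bC; apply: bmf_indic; [exact: (z point)|exact: smallest_sigma_algebra|].
by apply: sub_sigma_algebra; exists C.
Qed.

(** On boxes, integrating out both copies of coordinate [k] gives the product of [p (B k)] and
    [p (C k)] over the common rest event, which is symmetric. The two functions are then freed one
    after the other. *)
Lemma resample_exchange f g : bounded_measurable BS f -> bounded_measurable BS g ->
  Ex P (fun w => f (z w) * g (resample w)) = Ex P (fun w => f (resample w) * g (z w)).
Proof.
have [p [bp [_ pp]]] := kernel => bf bg.
have mr := measurable_resample.
have comp_integ u h : measurable_wrt measurable BS u -> bounded_measurable BS h ->
    integ P (fun w => h (u w)).
  by move=> mu bh; exact/integ_bm/bm_comp.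
have Cf C : (forall j, borel (C j)) ->
  Ex P (fun w => f (z w) * \1_[set x : prod_topology T | forall j, C j (x j)] (resample w)) =
  Ex P (fun w => f (resample w) * \1_[set x : prod_topology T | forall j, C j (x j)] (z w)).
  move=> bC; apply: Ex_box => //; try by apply: comp_integ => //; exact: bbox.
  move=> B bB.
  transitivity (Ex P (fun w => \1_(rest B) w * \1_(rest C) w * (p (C k) w * p (B k) w))).
    rewrite -pp //; last by apply: bGM; exact: bG_rest.
    by congr Ex; apply/funext => w; rewrite indic_box_z indic_box_resample; ring.
  under eq_fun do rewrite (mulrC (p (C k) _)).
  rewrite -pp //; last by apply: bGM; exact: bG_rest.
  by congr Ex; apply/funext => w; rewrite indic_box_z indic_box_resample; ring.
under eq_fun do rewrite mulrC; under [in RHS]eq_fun do rewrite mulrC.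
apply: Ex_box => //; try exact: comp_integ.
by move=> C bC; under eq_fun do rewrite mulrC; under [in RHS]eq_fun do rewrite mulrC; exact: Cf.
Qed.

Lemma resample_cond_exp f g Y : bounded_measurable BS f -> bounded_measurable BS g ->
  is_cond_exp P (sigma_except z k) (g \o z) Y ->
  Ex P (fun w => f (z w) * g (resample w)) = Ex P (fun w => f (z w) * Y w).
Proof.
have [p [bp [p1 pp]]] := kernel => bf bg cY.
have mr := measurable_resample; have Gm := sigma_except_measurable.
have comp_integ u h : measurable_wrt measurable BS u -> bounded_measurable BS h ->
    integ P (fun w => h (u w)).
  by move=> mu bh; exact/integ_bm/bm_comp.
have iY : integ P Y by have [] := cY.
have [Y' [bY' YY']] : exists Y', bG Y' /\ {ae P, forall w, Y' w = Y w}.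
  have [_ [K gK]] := bg; apply: (cond_exp_clip sG Gm cY (a := - K) (b := K)).
  by move=> w; rewrite -ler_norml; exact: gK.
have iY' : integ P Y' by exact/integ_bm/(bG_bm Gm).
have aeY h : @bounded_measurable R W measurable h ->
    Ex P (fun w => h w * Y w) = Ex P (fun w => h w * Y' w).
  move=> bh; apply: Ex_ae_eq; try exact: integM.
  by apply: filterS YY' => w ->.
apply: Ex_box => //; first exact: comp_integ.
move=> B bB; have bBk := bp _ (bB k).
have bh := bGM (bG_rest bB) bBk.
transitivity (Ex P (fun w => g (resample w) * (\1_(rest B) w * \1_(B k) (z w k)))).
  by congr Ex; apply/funext => w; rewrite indic_box_z; ring.
(* Given the other coordinates, [z w k] integrates out to [p (B k)] by independence, and the fresh
   copy inside [resample] may then be renamed [z w k], having the same conditional law. *)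
transitivity (Ex P (fun w => g (z w) * (\1_(rest B) w * p (B k) w))).
  apply: Ex_box => //.
  - apply: integM; first exact: (bG_bm Gm (bG_rest bB)).
    by apply/integ_bm/bm_indic; exact: measurable_coord.
  - exact: (integ_bm P (bG_bm Gm bh)).
  move=> C bC.
  transitivity (Ex P (fun w => \1_(rest C) w * \1_(rest B) w * (p (C k) w * p (B k) w))).
    rewrite -pp //; last by apply: bGM; exact: bG_rest.
    by congr Ex; apply/funext => w; rewrite indic_box_resample; ring.
  transitivity (Ex P (fun w => \1_(rest C) w * \1_(rest B) w * p (B k) w * \1_(C k) (z w k))).
    rewrite (p1 (C k) _ (bC k) _).2; last by do !apply: bGM => //; exact: bG_rest.
    by congr Ex; apply/funext => w; ring.
  by congr Ex; apply/funext => w; rewrite indic_box_z; ring.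
transitivity (Ex P (fun w => (\1_(rest B) w * p (B k) w) * (g \o z) w)).
  by congr Ex; apply/funext => w; rewrite mulrC.
rewrite (cond_exp_test sG Gm cY bh) aeY; last exact: (bG_bm Gm bh).
rewrite aeY; last by apply: bm_comp => //; exact: bbox.
(* All factors beside [p (B k)] are now measurable without coordinate [k], so [p (B k)] can be
   turned back into the indicator it is the conditional probability of. *)
transitivity (Ex P (fun w => (\1_(rest B) w * Y' w) * p (B k) w)).
  by congr Ex; apply/funext => w; ring.
rewrite -(p1 (B k) _ (bB k) _).2; last by apply: bGM => //; exact: bG_rest.
by congr Ex; apply/funext => w; rewrite indic_box_z; ring.
Qed.

End resampling.

(** * Matrix-valued functions *)

Section matrix_functions.
Context {R : realType} {X : choiceType} (x0 : X).
Variables (F : set (set X)) (sF : sigma_algebra setT F).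
Context {d : nat}.
Implicit Types M N : X -> 'M[R[i]]_d.

Definition bounded_measurable_mx M := forall i j,
  @bounded_measurable R X F (fun x => complex.Re (M x i j)) /\
  @bounded_measurable R X F (fun x => complex.Im (M x i j)).

Lemma bmx_cst (A : 'M[R[i]]_d) : bounded_measurable_mx (fun=> A).
Proof. by move=> i j; split; exact: (bmf_cst x0 sF). Qed.

Lemma bmxD M N : bounded_measurable_mx M -> bounded_measurable_mx N -> bounded_measurable_mx (fun x => M x + N x).
Proof.
move=> bM bN i j; have [rM iM] := bM i j; have [rN iN] := bN i j.
split; first by under eq_fun do rewrite mxE cReD; exact: (bmfD x0 sF).
by under eq_fun do rewrite mxE cImD; exact: (bmfD x0 sF).
Qed.

Lemma bmxN M : bounded_measurable_mx M -> bounded_measurable_mx (fun x => - M x).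
Proof.
move=> bM i j; have [rM iM] := bM i j.
split; first by under eq_fun do rewrite mxE cReN; exact: (bmfN x0 sF).
by under eq_fun do rewrite mxE cImN; exact: (bmfN x0 sF).
Qed.

Lemma bmxM M N : bounded_measurable_mx M -> bounded_measurable_mx N -> bounded_measurable_mx (fun x => M x *m N x).
Proof.
move=> bM bN i j; split.
  under eq_fun do rewrite mxE cRe_sum.
  apply: (bmf_sum x0 sF) => k; have [rM iM] := bM i k; have [rN iN] := bN k j.
  under eq_fun do rewrite cReM.
  by apply: (bmfD x0 sF); [|apply: (bmfN x0 sF)]; exact: (bmfM x0 sF).
under eq_fun do rewrite mxE cIm_sum.
apply: (bmf_sum x0 sF) => k; have [rM iM] := bM i k; have [rN iN] := bN k j.
under eq_fun do rewrite cImM.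
by apply: (bmfD x0 sF); exact: (bmfM x0 sF).
Qed.

Lemma bmf_hs M N : bounded_measurable_mx M -> bounded_measurable_mx N -> bounded_measurable F (fun x => hs (M x) (N x)).
Proof.
move=> bM bN; under eq_fun do rewrite hsE.
apply: (bmf_sum x0 sF) => i; apply: (bmf_sum x0 sF) => j.
have [rM iM] := bM i j; have [rN iN] := bN j i.
by apply: (bmfD x0 sF); [|apply: (bmfN x0 sF)]; exact: (bmfM x0 sF).
Qed.

Lemma bmx_exp M n : bounded_measurable_mx M -> bounded_measurable_mx (fun x => M x ^+ n).
Proof.
move=> bM; elim: n => [|n IHn].
  by under eq_fun do rewrite expr0; exact: bmx_cst.
by under eq_fun do rewrite exprS; exact: bmxM.
Qed.

Lemma bmx_texp M (th : R) : (forall x, M x \is hermsymmx) -> 0 <= th -> bounded_measurable_mx M ->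
  bounded_measurable_mx (fun x => texp th (M x)).
Proof.
move=> hM th0 bM.
have [_ [K hK]] := bmf_hs bM bM.
pose L := Num.sqrt `|K|.
have hsL x : hs (M x) (M x) <= L ^+ 2.
  rewrite sqr_sqrtr // (le_trans (ler_norm _)) // (le_trans (hK x)) //.
  exact: ler_norm.
have part n (f : nat -> X -> R) : (forall k, bounded_measurable F (f k)) ->
    measurable_wrt F (measurable : set (set R))
     (fun x => \sum_(k < n) (th ^+ k / k`!%:R) * f k x).
  move=> bf; have [//] : bounded_measurable F (fun x => \sum_(k < n) (th ^+ k / k`!%:R) * f k x).
  apply: (bmf_sum x0 sF) => k; apply: (bmfM x0 sF) => //; exact: (bmf_cst x0 sF).
move=> i j; split; split.
- apply: (mwrt_cvg x0 sF); last by move=> x; have [cv _] := texp_cvg th i j (hM x); exact: cv.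
  by move=> n; apply: (part n (fun k x => complex.Re ((M x ^+ k) i j))) => k; have [] := bmx_exp k bM i j.
- exists (d%:R * expR (th * L)) => x.
  by have [] := texp_entry_le i j (hM x) th0 (hsL x) (sqrtr_ge0 _).
- apply: (mwrt_cvg x0 sF); last by move=> x; have [_ cv] := texp_cvg th i j (hM x); exact: cv.
  by move=> n; apply: (part n (fun k x => complex.Im ((M x ^+ k) i j))) => k; have [] := bmx_exp k bM i j.
- exists (d%:R * expR (th * L)) => x.
  by have [] := texp_entry_le i j (hM x) th0 (hsL x) (sqrtr_ge0 _).
Qed.

End matrix_functions.

Section matrix_expectation.
Context disp (W : measurableType disp) (R : realType) (P : probability W R) (d : nat).
Implicit Types M N : W -> 'M[R[i]]_d.

Definition integ_hs M N := forall i j,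
  integ P (fun w => complex.Re (M w i j) * complex.Re (N w j i)) /\
  integ P (fun w => complex.Im (M w i j) * complex.Im (N w j i)).

Lemma integ_hsP M N : integ_hs M N -> integ P (fun w => hs (M w) (N w)).
Proof.
move=> iMN; under eq_fun do rewrite hsE.
apply: integ_sum => i; apply: integ_sum => j; have [? ?] := iMN i j.
exact: integB.
Qed.

Lemma Ex_hs M N : integ_hs M N -> Ex P (fun w => hs (M w) (N w)) =
  \sum_i \sum_j (Ex P (fun w => complex.Re (M w i j) * complex.Re (N w j i)) -
                 Ex P (fun w => complex.Im (M w i j) * complex.Im (N w j i))).
Proof.
move=> iMN; under eq_fun do rewrite hsE.
rewrite Ex_sum => [|i]; last first.
  by apply: integ_sum => j; have [? ?] := iMN i j; exact: integB.
apply: eq_bigr => i _; rewrite Ex_sum => [|j].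
  by apply: eq_bigr => j _; have [? ?] := iMN i j; rewrite ExB.
by have [? ?] := iMN i j; exact: integB.
Qed.

Lemma Ex_hs_eq M N M' N' : integ_hs M N -> integ_hs M' N' ->
  (forall i j,
    Ex P (fun w => complex.Re (M w i j) * complex.Re (N w j i)) =
    Ex P (fun w => complex.Re (M' w i j) * complex.Re (N' w j i)) /\
    Ex P (fun w => complex.Im (M w i j) * complex.Im (N w j i)) =
    Ex P (fun w => complex.Im (M' w i j) * complex.Im (N' w j i))) ->
  Ex P (fun w => hs (M w) (N w)) = Ex P (fun w => hs (M' w) (N' w)).
Proof.
move=> iMN iMN' E; rewrite !Ex_hs //.
by apply: eq_bigr => i _; apply: eq_bigr => j _; have [-> ->] := E i j.
Qed.

Lemma integ_hs_bm M N : (bounded_measurable_mx measurable M) ->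
  (forall i j, integ P (fun w => complex.Re (N w i j)) /\
               integ P (fun w => complex.Im (N w i j))) -> integ_hs M N.
Proof.
move=> bM iN i j; have [rM iM] := bM i j; have [rN imN] := iN j i.
by split; apply: integM.
Qed.

Lemma bmx_integ N : bounded_measurable_mx measurable N ->
  forall i j, integ P (fun w => complex.Re (N w i j)) /\
              integ P (fun w => complex.Im (N w i j)).
Proof. by move=> bN i j; have [? ?] := bN i j; split; exact: integ_bm. Qed.

Lemma cond_exp_mx_hs (G : set (set W)) M X Y :
  sigma_algebra setT G -> G `<=` measurable -> is_cond_exp_mx P G X Y ->
  bounded_measurable_mx G M -> Ex P (fun w => hs (M w) (X w)) = Ex P (fun w => hs (M w) (Y w)).
Proof.
move=> sG Gm cXY bM.
have bM' : bounded_measurable_mx measurable M.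
  by move=> i j; have [? ?] := bM i j; split; exact: (bG_bm Gm).
apply: Ex_hs_eq.
- by apply: integ_hs_bm => // i j; have [[? _ _ _] [? _ _ _]] := cXY i j.
- by apply: integ_hs_bm => // i j; have [[_ ? _ _] [_ ? _ _]] := cXY i j.
- move=> i j; have [rM iM] := bM i j; have [cR cI] := cXY j i.
  by split; exact: (cond_exp_test sG Gm).
Qed.

End matrix_expectation.

(** * A discrete Gronwall inequality *)

Section gronwall.
Context {R : realType}.

(** Bounds the backward Euler factor [1 / (1 - x)] by an exponential with quadratic error, which
    disappears as the steps shrink. *)
Lemma expR_inv_1B (x : R) : 0 <= x <= 2^-1 -> 1 <= (1 - x) * expR (x + 2 * x ^+ 2).
Proof.
move=> /andP[x0 x2]; have x1 : 0 <= 1 - x by lra.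
apply: le_trans (ler_wpM2l x1 (expR_ge1Dx _)).
have : 0 <= x ^+ 2 * (1 - 2 * x) by rewrite mulr_ge0 ?sqr_ge0 //; lra.
by rewrite expr2; nra.
Qed.

(* The hypothesis is the backward Euler form of [m' <= c t m]. *)
Lemma gronwall_backward (c : R) (m : R -> R) (T : R) : 0 <= c -> 0 <= T ->
  (forall t, 0 <= m t) ->
  (forall t t', 0 <= t' -> t' <= t -> m t - m t' <= (t - t') * (c * t * m t)) ->
  m T <= m 0 * expR (c * T ^+ 2 / 2).
Proof.
move=> c0 T0 m0 step.
(* Dividing by the expected solution reduces the claim to [g T <= g 0]. *)
pose g t := m t * expR (- (c * t ^+ 2 / 2)).
have g0 t : 0 <= g t by rewrite mulr_ge0 ?expR_ge0.
(* [C] bounds the error of one step: [c / 2] comes from using the right endpoint [c * t] in place of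
   its average over the step, and the square from [expR_inv_1B]. *)
pose C := c / 2 + 2 * (c * T) ^+ 2.
have C0 : 0 <= C by rewrite addr_ge0 ?mulr_ge0 ?sqr_ge0 // invr_ge0.
have gstep t t' : 0 <= t' -> t' <= t -> t <= T -> (t - t') * (c * t) <= 2^-1 ->
    g t <= g t' * expR (C * (t - t') ^+ 2).
  move=> t'0 t't tT; set x := (t - t') * (c * t) => x2.
  have t0 : 0 <= t by exact: le_trans t't.
  have x0 : 0 <= x by rewrite !mulr_ge0 // subr_ge0.
  have h1 : m t * (1 - x) <= m t'.
    by have := step t t' t'0 t't; rewrite /x; lra.
  have h2 : m t <= m t' * expR (x + 2 * x ^+ 2).
    apply: le_trans (ler_wpM2r (expR_ge0 _) h1).
    by rewrite -mulrA ler_peMr // expR_inv_1B // x0.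
  have xC : x + 2 * x ^+ 2 - c * t ^+ 2 / 2 <= C * (t - t') ^+ 2 - c * t' ^+ 2 / 2.
    have ct : (c * t) ^+ 2 <= (c * T) ^+ 2.
      by rewrite lerXn2r ?nnegrE ?mulr_ge0 // ler_wpM2l.
    have := ler_wpM2l (sqr_ge0 (t - t')) ct; rewrite /C /x !exprMn.
    by move: (T ^+ 2) => T2 h; nra.
  rewrite /g; apply: le_trans (ler_wpM2r (expR_ge0 _) h2) _.
  rewrite -!mulrA -!expRD; apply: ler_wpM2l => //; rewrite ler_expR.
  by move: xC; rewrite !mulrA; lra.
(* Each of [N] equal steps costs a factor of exponent [C * (T / N)^2], so the total exponent is of
   order [1 / N]. *)
have gn N : (0 < N)%N -> c * T ^+ 2 <= N%:R / 2 ->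
    g T <= g 0 * expR (C * T ^+ 2 / N%:R).
  move=> N0 NT; have N0' : 0 < N%:R :> R by rewrite ltr0n.
  pose h := T / N%:R; have h0 : 0 <= h by rewrite divr_ge0 // ltW.
  have hN : N%:R * h = T by rewrite mulrC divfK // gt_eqF.
  suff gj j : (j <= N)%N -> g (j%:R * h) <= g 0 * expR (j%:R * (C * h ^+ 2)).
    have := gj N (leqnn _); rewrite hN; congr (_ <= _ * expR _).
    by rewrite /h exprMn exprVn expr2; field; rewrite gt_eqF.
  elim: j => [|j IHj] jN; first by rewrite !mul0r expR0 mulr1.
  have jh : j.+1%:R * h <= T by rewrite -hN ler_wpM2r // ler_nat.
  have dh : j.+1%:R * h - j%:R * h = h by rewrite -mulrBl mulrSr addrC addKr mul1r.
  have := gstep (j.+1%:R * h) (j%:R * h); rewrite dh => /(_ _ _ jh _) H.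
  apply: le_trans (H _ _ _) _.
  - by rewrite mulr_ge0.
  - by rewrite -subr_ge0 dh.
  - apply: (@le_trans _ _ (h * (c * T))).
      by apply: ler_wpM2l => //; exact: ler_wpM2l.
    by rewrite /h mulrAC ler_pdivrMr //; move: NT; rewrite expr2; lra.
  - apply: le_trans (ler_wpM2r (expR_ge0 _) (IHj (ltnW jN))) _.
    have -> : j.+1%:R * (C * h ^+ 2) = j%:R * (C * h ^+ 2) + C * h ^+ 2.
      by rewrite -natr1; ring.
    by rewrite -mulrA -expRD.
suff gT : g T <= g 0.
  move: gT; rewrite /g expr0n /= mulr0 mul0r oppr0 expR0 mulr1 => gT.
  by have := ler_wpM2r (expR_ge0 (c * T ^+ 2 / 2)) gT;
    rewrite -[m T * _ * _]mulrA -expRD addNr expR0 mulr1.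
apply/ler_addgt0Pr => e e0; pose D := C * T ^+ 2.
have D0 : 0 <= D by rewrite mulr_ge0 ?sqr_ge0.
(* The first term makes [N] large enough for the step-size condition, the second makes the
   accumulated error at most [e]. *)
pose B := 2 * (c * T ^+ 2) + g T * D / e.
have B0 : 0 <= B by rewrite addr_ge0 ?mulr_ge0 ?sqr_ge0 // invr_ge0 ltW.
pose N := (Num.truncn B).+1; have BN : B < N%:R by exact: truncnS_gt.
have N0 : 0 < N%:R :> R by rewrite ltr0n.
have gDe : 0 <= g T * D / e by rewrite !mulr_ge0 // invr_ge0 ltW.
have cT0 : 0 <= c * T ^+ 2 by rewrite mulr_ge0 ?sqr_ge0.
have h1 := gn N isT; have {h1} h1 : g T <= g 0 * expR (D / N%:R).
  by apply: h1; rewrite ler_pdivlMr // mulrC; move: BN; rewrite /B; lra.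
have h2 : g T * (1 - D / N%:R) <= g 0.
  apply: (@le_trans _ _ (g T * expR (- (D / N%:R)))).
    by apply: ler_wpM2l => //; exact: expR_ge1Dx.
  have := ler_wpM2r (expR_ge0 (- (D / N%:R))) h1.
  by rewrite -[g 0 * _ * _]mulrA -expRD subrr expR0 mulr1.
have h3 : g T * D / N%:R <= e.
  rewrite ler_pdivrMr // (mulrC e) -ler_pdivrMr //.
  by move: BN; rewrite /B; lra.
by move: h2; rewrite mulrBr mulr1 mulrA; lra.
Qed.

End gronwall.

(** * The Stein-type bound for one coordinate *)

Lemma hermsymB (R : realType) d (A B : 'M[R[i]]_d) :
  A \is hermsymmx -> B \is hermsymmx -> A - B \is hermsymmx.
Proof.
by rewrite !hermsymE linearB /= map_mxB => /eqP <- /eqP <-.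
Qed.

Section one_coordinate.
Context disp (W : measurableType disp) (R : realType) (P : probability W R).
Context {n : nat} {T : 'I_n -> topologicalType}.
Hypothesis hT : forall k, polish R (T k).
Variables (z : W -> prod_topology T).
Hypothesis mz : measurable_wrt measurable (@borel (prod_topology T)) z.
Context {d : nat}.
Implicit Types M N : prod_topology T -> 'M[R[i]]_d.

Local Notation BS := <<s @borel_box n T >>.
Local Notation bS := (bounded_measurable_mx (@borel (prod_topology T))).

Let x0 : prod_topology T := z point.
Let sB : sigma_algebra setT (@borel (prod_topology T)).
Proof. exact: smallest_sigma_algebra. Qed.

Let bmf_box (f : prod_topology T -> R) :
  bounded_measurable (@borel (prod_topology T)) f -> bounded_measurable BS f.
Proof.
by move=> [mf fK]; split => // B mB; apply: (borel_prod_sub hT); exact: mf.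
Qed.

Lemma bmx_comp (y : W -> prod_topology T) M :
  measurable_wrt measurable BS y -> bS M -> bounded_measurable_mx measurable (fun w => M (y w)).
Proof.
move=> my bM i j; have [rM iM] := bM i j.
by split; [exact: (bm_comp my (bmf_box rM))|exact: (bm_comp my (bmf_box iM))].
Qed.

Lemma bmx_sigma_of M : bS M -> bounded_measurable_mx (sigma_of z) (fun w => M (z w)).
Proof.
move=> bM i j; have [[mr [K rK]] [mi [L iL]]] := bM i j.
split; split.
- by move=> B mB; exists ((fun x => complex.Re (M x i j)) @^-1` B); [exact: mr|rewrite setTI].
- by exists K.
- by move=> B mB; exists ((fun x => complex.Im (M x i j)) @^-1` B); [exact: mi|rewrite setTI].
- by exists L.
Qed.

Let mzB : measurable_wrt measurable BS z.
Proof. by apply: measurable_boxes => j; exact: measurable_coord. Qed.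

Lemma sigma_of_sub : sigma_of z `<=` measurable.
Proof. by move=> _ [B bB <-]; rewrite setTI; exact: mz. Qed.

Lemma sigma_of_algebra : sigma_algebra setT (sigma_of z).
Proof. exact: sigma_algebra_preimage. Qed.

Variables (k : 'I_n) (zk : W -> T k).
Hypothesis mzk : measurable_wrt measurable (@borel (T k)) zk.
Hypothesis ciid : cond_iid P (sigma_except z k) zk (fun w => z w k).

Let r w : prod_topology T := resample z zk w.
Let mr : measurable_wrt measurable BS r := measurable_resample mz mzk.

Lemma hs_exchange M N : bS M -> bS N ->
  Ex P (fun w => hs (M (z w)) (N (r w))) = Ex P (fun w => hs (M (r w)) (N (z w))).
Proof.
move=> bM bN; have bzM := bmx_comp mzB bM; have brM := bmx_comp mr bM.
apply: Ex_hs_eq.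
- by apply: integ_hs_bm => //; apply: bmx_integ; exact: bmx_comp.
- by apply: integ_hs_bm => //; apply: bmx_integ; exact: bmx_comp.
- move=> i j; have [rM iM] := bM i j; have [rN iN] := bN j i.
  split; first exact: (resample_exchange mz mzk ciid (bmf_box rM) (bmf_box rN)).
  exact: (resample_exchange mz mzk ciid (bmf_box iM) (bmf_box iN)).
Qed.

Lemma hs_cond_exp M N (Y : W -> 'M[R[i]]_d) : bS M -> bS N ->
  is_cond_exp_mx P (sigma_except z k) (N \o z) Y ->
  Ex P (fun w => hs (M (z w)) (N (r w))) = Ex P (fun w => hs (M (z w)) (Y w)).
Proof.
move=> bM bN cY; have bzM := bmx_comp mzB bM.
apply: Ex_hs_eq.
- by apply: integ_hs_bm => //; apply: bmx_integ; exact: bmx_comp.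
- by apply: integ_hs_bm => // i j; have [[_ ? _ _] [_ ? _ _]] := cY i j.
- move=> i j; have [rM iM] := bM i j; have [rN iN] := bN j i; have [cR cI] := cY j i.
  split; first exact: (resample_cond_exp mz mzk ciid (bmf_box rM) (bmf_box rN) cR).
  exact: (resample_cond_exp mz mzk ciid (bmf_box iM) (bmf_box iN) cI).
Qed.

Let integ_hs_comp (u v : W -> prod_topology T) M N :
  measurable_wrt measurable BS u -> measurable_wrt measurable BS v ->
  bS M -> bS N -> integ P (fun w => hs (M (u w)) (N (v w))).
Proof.
move=> mu mv bM bN; apply: integ_hsP; apply: integ_hs_bm; first exact: bmx_comp.
by apply: bmx_integ; exact: bmx_comp.
Qed.

Let bMM M N : bS M -> bS N -> bS (fun x => M x *m N x).
Proof. exact: (bmxM x0 sB). Qed.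

(** Cyclicity gathers everything evaluated at the second point into one factor, so that
    [hs_exchange] applies term by term. *)
Lemma hs_sq_expand (X Y N : 'M[R[i]]_d) : hs ((X - Y) *m (X - Y)) N =
  hs (X *m X) N - hs X (Y *m N) - hs X (N *m Y) + hs 1%:M (Y *m Y *m N).
Proof.
rewrite mulmxBl !mulmxBr !hsBl (hsC 1%:M) -(hs_mul1 (Y *m Y)) (hsMl X Y) (hsMr Y X).
by rewrite opprB addrA addrAC.
Qed.

Let Ex_sq_expand (u v : W -> prod_topology T) M N :
  measurable_wrt measurable BS u -> measurable_wrt measurable BS v ->
  bS M -> bS N ->
  Ex P (fun w => hs ((M (u w) - M (v w)) *m (M (u w) - M (v w))) (N (v w))) =
  Ex P (fun w => hs (M (u w) *m M (u w)) (N (v w))) -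
  Ex P (fun w => hs (M (u w)) (M (v w) *m N (v w))) -
  Ex P (fun w => hs (M (u w)) (N (v w) *m M (v w))) +
  Ex P (fun w => hs 1%:M (M (v w) *m M (v w) *m N (v w))).
Proof.
move=> mu mv bM bN; under eq_fun do rewrite hs_sq_expand.
have i1 := integ_hs_comp mu mv (bMM bM bM) bN.
have i2 := integ_hs_comp mu mv bM (bMM bM bN).
have i3 := integ_hs_comp mu mv bM (bMM bN bM).
have i4 := integ_hs_comp mu mv (bmx_cst x0 sB 1%:M) (bMM (bMM bM bM) bN).
rewrite (ExD (integB (integB i1 i2) i3) i4) (ExB (integB i1 i2) i3).
by rewrite (ExB i1 i2).
Qed.

Lemma hs_sq_exchange M N : bS M -> bS N ->
  Ex P (fun w => hs ((M (z w) - M (r w)) *m (M (z w) - M (r w))) (N (r w))) =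
  Ex P (fun w => hs ((M (z w) - M (r w)) *m (M (z w) - M (r w))) (N (z w))).
Proof.
move=> bM bN.
transitivity (Ex P (fun w => hs ((M (r w) - M (z w)) *m (M (r w) - M (z w))) (N (z w)))).
  apply: etrans (Ex_sq_expand mzB mr bM bN) _.
  apply: etrans _ (esym (Ex_sq_expand mr mzB bM bN)).
  have e1 := hs_exchange (bMM bM bM) bN.
  have e2 := hs_exchange bM (bMM bM bN).
  have e3 := hs_exchange bM (bMM bN bM).
  have e4 := hs_exchange (bmx_cst x0 sB 1%:M) (bMM (bMM bM bM) bN).
  have addE (a b c e : R) : a = b -> c = e -> a + c = b + e by move=> -> ->.
  have subE (a b c e : R) : a = b -> c = e -> a - c = b - e by move=> -> ->.
  exact: (addE _ _ _ _ (subE _ _ _ _ (subE _ _ _ _ e1 e2) e3) e4).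
apply: (congr1 (Ex P)); apply/funext => w.
suff -> : (M (r w) - M (z w)) *m (M (r w) - M (z w)) =
  (M (z w) - M (r w)) *m (M (z w) - M (r w)) by [].
by rewrite -[M (r w) - _]opprB mulNmx mulmxN opprK.
Qed.

Lemma hs_resample M N : bS M -> bS N ->
  Ex P (fun w => hs (M (z w)) (N (z w))) = Ex P (fun w => hs (M (r w)) (N (r w))).
Proof.
move=> bM bN; have eq1 (u : W -> prod_topology T) :
    (fun w => hs (M (u w)) (N (u w))) = (fun w => hs (M (u w) *m N (u w)) 1%:M).
  by apply/funext => w; rewrite hs_mul1.
by rewrite !eq1; exact: (hs_exchange (bMM bM bN) (bmx_cst x0 sB 1%:M)).
Qed.

Variables (H E : prod_topology T -> 'M[R[i]]_d) (th : R).
Hypotheses (bH : bS H) (bE : bS E) (th0 : 0 <= th).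
Hypothesis mean_value : forall x y, hs (H x - H y) (E x - E y) <=
  th / 2 * hs ((H x - H y) *m (H x - H y)) (E x + E y).
Hypothesis E_psd : forall (Q : 'M[R[i]]_d) x, psdmx Q -> 0 <= hs Q (E x).
Variables (EH V : W -> 'M[R[i]]_d) (A : 'M[R[i]]_d).
Hypothesis cEH : is_cond_exp_mx P (sigma_except z k) (H \o z) EH.
Hypothesis cV : is_cond_exp_mx P (sigma_of z)
  (fun w => (H (z w) - H (r w)) *m (H (z w) - H (r w))) V.
Hypothesis VA : {ae P, forall w, loewner_le (V w) (A *m A)}.

Let D w := (H (z w) - H (r w)) *m (H (z w) - H (r w)).

Let bD : bounded_measurable_mx measurable D.
Proof.
have bz := bmx_comp mzB bH; have br := bmx_comp mr bH.
have sm := @sigma_algebra_measurable _ W.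
have bd := bmxD point sm bz (bmxN point sm br).
exact: (bmxM point sm bd bd).
Qed.

Let iD (u : W -> prod_topology T) : measurable_wrt measurable BS u ->
  integ P (fun w => hs (D w) (E (u w))).
Proof.
move=> mu; apply: integ_hsP; apply: integ_hs_bm; first exact: bD.
by apply: bmx_integ; exact: bmx_comp.
Qed.

(** Of the four terms, the two diagonal ones agree by equality in law and the two mixed ones by
    exchangeability; hence the factor 2. *)
Let exchange_diff :
  Ex P (fun w => hs (H (z w) - H (r w)) (E (z w) - E (r w))) =
  2 * (Ex P (fun w => hs (H (z w)) (E (z w))) - Ex P (fun w => hs (H (r w)) (E (z w)))).
Proof.
have izz := integ_hs_comp mzB mzB bH bE; have irr := integ_hs_comp mr mr bH bE.
have izr := integ_hs_comp mzB mr bH bE; have irz := integ_hs_comp mr mzB bH bE.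
have -> : (fun w => hs (H (z w) - H (r w)) (E (z w) - E (r w))) =
  (fun w => (hs (H (z w)) (E (z w)) - hs (H (z w)) (E (r w))) -
            (hs (H (r w)) (E (z w)) - hs (H (r w)) (E (r w)))).
  by apply/funext => w; rewrite hsBl !hsBr.
rewrite (ExB (integB izz izr) (integB irz irr)) (ExB izz izr) (ExB irz irr).
rewrite (hs_exchange bH bE) -(hs_resample bH bE).
move: (Ex P _) (Ex P _) => a b; ring.
Qed.

Let exchange_mean_value :
  Ex P (fun w => hs (H (z w)) (E (z w))) - Ex P (fun w => hs (H (r w)) (E (z w))) <=
  th / 2 * Ex P (fun w => hs (D w) (E (z w))).
Proof.
have iz := iD mzB; have ir := iD mr.
have le1 : Ex P (fun w => hs (H (z w) - H (r w)) (E (z w) - E (r w))) <=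
    Ex P (fun w => th / 2 * (hs (D w) (E (z w)) + hs (D w) (E (r w)))).
  apply: Ex_le; last by move=> w; rewrite -hsDr; exact: mean_value.
    have -> : (fun w => hs (H (z w) - H (r w)) (E (z w) - E (r w))) =
      (fun w => (hs (H (z w)) (E (z w)) - hs (H (z w)) (E (r w))) -
                (hs (H (r w)) (E (z w)) - hs (H (r w)) (E (r w)))).
      by apply/funext => w; rewrite hsBl !hsBr.
    by apply: integB; apply: integB; exact: integ_hs_comp.
  exact: (integZ _ (integD iz ir)).
move: le1; rewrite exchange_diff (ExZ _ (integD iz ir)) (ExD iz ir).
(* The squared difference is symmetric in the pair, so both exponentials contribute equally and the
   factor 2 on the left cancels. *)
have -> : Ex P (fun w => hs (D w) (E (r w))) = Ex P (fun w => hs (D w) (E (z w))).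
  exact: hs_sq_exchange bH bE.
move: (Ex P _) (Ex P _) (Ex P _) => a b c h.
rewrite -(ler_pM2l (ltr0n R 2)) (le_trans h) //.
by rewrite mulrDr mulr_natl mulr2n.
Qed.

(** [E] stands for the matrix exponential of [H]. Since [E (z w)] depends on [z] alone, [H] at the
    resampled point may be replaced by [EH], and the squared difference by [V], hence by
    [A *m A]. *)
Lemma coordinate_ineq :
  Ex P (fun w => hs (H (z w)) (E (z w))) - Ex P (fun w => hs (EH w) (E (z w))) <=
  th / 2 * Ex P (fun w => hs (A *m A) (E (z w))).
Proof.
have hsC_fun (X Y : W -> 'M[R[i]]_d) :
    (fun w => hs (X w) (Y w)) = (fun w => hs (Y w) (X w)).
  by apply/funext => w; exact: hsC.
have -> : Ex P (fun w => hs (EH w) (E (z w))) = Ex P (fun w => hs (H (r w)) (E (z w))).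
  rewrite (hsC_fun EH) (hsC_fun (fun w => H (r w))).
  exact: esym (hs_cond_exp bE bH cEH).
apply: le_trans exchange_mean_value _; apply: ler_wpM2l; first by rewrite divr_ge0.
rewrite !(hsC_fun _ (fun w => E (z w))).
rewrite (cond_exp_mx_hs sigma_of_algebra sigma_of_sub cV (bmx_sigma_of bE)).
apply: Ex_ae_le.
- apply: integ_hsP; apply: integ_hs_bm; first exact: bmx_comp.
  by move=> i j; have [[_ ? _ _] [_ ? _ _]] := cV i j.
- exact: integ_hs_comp mzB mzB bE (bmx_cst x0 sB (A *m A)).
- apply: filterS VA => w psd; rewrite -subr_ge0 -hsBr hsC.
  exact: E_psd.
Qed.

End one_coordinate.

(** * Consequences of the bound on the moment generating function *)

Lemma hs_self_texp (R : realType) d (A : 'M[R[i]]_d) (th : R) : A \is hermsymmx ->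
  hs A (texp th A) = \sum_i eigval A i * expR (th * eigval A i).
Proof. by move=> hA; rewrite /hs (mulmx_fmxl _ hA) tr_fmx. Qed.

(** Convexity, eigenvalue by eigenvalue: the tangent to the exponential at [t * a] lies below the
    graph at [t' * a]. The slope is taken at the later time [t], as [gronwall_backward] demands. *)
Lemma tr_texp_diff (R : realType) d (A : 'M[R[i]]_d) (t t' : R) : A \is hermsymmx ->
  complex.Re (\tr (texp t A)) - complex.Re (\tr (texp t' A)) <=
  (t - t') * hs A (texp t A).
Proof.
move=> hA; have trE u : complex.Re (\tr (texp u A)) =
    \sum_i expR (u * eigval A i) by exact: tr_fmx.
rewrite [X in X - _ <= _](trE t) [X in _ - X <= _](trE t').
rewrite [X in _ <= _ * X](hs_self_texp t hA) -sumrB mulr_sumr.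
apply: ler_sum => i _; set a := eigval A i.
have -> : expR (t' * a) = expR (t * a) * expR (- ((t - t') * a)).
  by rewrite -expRD; congr expR; ring.
have := ler_wpM2l (expR_ge0 (t * a)) (expR_ge1Dx (- ((t - t') * a))).
by move: (expR (t * a)) (expR _) => u v h; nra.
Qed.

(** The largest eigenvalue is the pointwise limit of the soft maxima [ln (tr k x) / (k + 1)], whose
    error is at most [ln d%:R / (k + 1)]. *)
Lemma bmf_lambda_max (R : realType) (X : choiceType) (x0 : X) (F : set (set X)) d
    (M : X -> 'M[R[i]]_d) : sigma_algebra setT F -> (0 < d)%N ->
  (forall x, M x \is hermsymmx) -> bounded_measurable_mx F M ->
  bounded_measurable F (fun x => lambda_max (M x)).
Proof.
move=> sF d0 hM bM; split; last first.
  have [_ [K hK]] := bmf_hs x0 sF bM bM.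
  exists (Num.sqrt `|K|) => x.
  have [i ->] := lambda_max_attained d0 (hM x).
  rewrite -sqrtr_sqr ler_wsqrtr // (le_trans (eigval_sqr_le i (hM x))) //.
  by rewrite (le_trans (ler_norm _)) // (le_trans (hK x)) // ler_norm.
pose tr k x := complex.Re (\tr (texp k.+1%:R (M x))).
apply: (mwrt_cvg x0 sF (h := fun k x => k.+1%:R^-1 * ln (tr k x))) => [k|x].
  have btr : bounded_measurable F (tr k).
    have := bmf_hs x0 sF (bmx_texp x0 sF hM (ler0n R k.+1) bM) (bmx_cst x0 sF 1%:M).
    by rewrite /hs; under eq_fun do rewrite mulmx1.
  apply: (mwrtM x0 sF); first exact: (mwrt_cst x0 sF).
  exact: (mwrt_comp x0 sF (@measurable_ln R) btr.1).
set l := lambda_max (M x).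
apply: (@squeeze_cvgr _ _ _ _ (fun=> l) (fun k => l + k.+1%:R^-1 * ln d%:R)).
- apply: nearW => k; have k0 : 0 < k.+1%:R :> R by rewrite ltr0n.
  have d0' : 0 < d%:R :> R by rewrite ltr0n.
  have lo : expR (k.+1%:R * l) <= tr k x by exact: expR_lambda_max_le.
  have hi : tr k x <= d%:R * expR (k.+1%:R * l) by exact: tr_texp_le.
  have tr0 : 0 < tr k x by apply: lt_le_trans lo; exact: expR_gt0.
  apply/andP; split.
    rewrite mulrC ler_pdivlMr // mulrC -[leLHS]expRK.
    by rewrite ler_ln ?posrE // expR_gt0.
  rewrite mulrC ler_pdivrMr // mulrDl mulrAC mulVf ?gt_eqF // mul1r.
  have -> : l * k.+1%:R + ln d%:R = ln (d%:R * expR (k.+1%:R * l)).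
    by rewrite lnM ?posrE ?expR_gt0 // expRK addrC mulrC.
  by rewrite ler_ln ?posrE // mulr_gt0 // expR_gt0.
- exact: cvg_cst.
- rewrite -[X in _ --> X]addr0 -[X in _ + X](mul0r (ln d%:R)).
  apply: cvgD; first exact: cvg_cst.
  by apply: cvgMr_tmp; exact: cvg_harmonic.
Qed.

Lemma bm_expR disp (W : measurableType disp) (R : realType) (th : R) (Y : W -> R) :
  bounded_measurable measurable Y -> bounded_measurable measurable (fun w => expR (th * Y w)).
Proof.
move=> bY; have sm := @sigma_algebra_measurable _ W.
have bt := bmfM point sm (bmf_cst point sm th) bY.
split; first exact: (mwrt_comp point sm (@measurable_expR R) bt.1).
have [_ [B hB]] := bt; exists (expR B) => w.
rewrite ger0_norm ?expR_ge0 // ler_expR.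
exact: le_trans (ler_norm _) (hB w).
Qed.

(** * Tail and mean from a subgaussian moment generating function *)

Section subgaussian.
Context disp (W : measurableType disp) (R : realType) (P : probability W R).
Variables (Y : W -> R) (K s L : R).
Hypotheses (bY : @bounded_measurable R W measurable Y) (K1 : 1 <= K) (s0 : 0 < s) (L0 : 0 <= L).
Hypothesis mgf : forall th, 0 <= th ->
  Ex P (fun w => expR (th * Y w)) <= K * expR (th ^+ 2 * L / (4 * s)).

Let bexp th := bm_expR th bY.

Let tail_set (t : R) := [set w | t <= Y w].

Let measurable_tail t : measurable (tail_set t).
Proof.
have [mY _] := bY; have := mY _ (measurable_itv `[t, +oo[).
by congr measurable; apply/seteqP; split => w; rewrite /= in_itv /= andbT.
Qed.

Lemma prob_Ex D : measurable D -> P D = (Ex P (\1_D))%:E.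
Proof.
move=> mD; rewrite /Ex /Rintegral fineK; last first.
  by apply: integrable_fin_num => //; exact/integ_bm/bm_indic.
by rewrite integral_indic // setIT.
Qed.

Lemma chernoff t th : 0 <= th ->
  Ex P (\1_(tail_set t)) <= K * expR (th ^+ 2 * L / (4 * s) - th * t).
Proof.
move=> th0; have iD := integ_bm P (bm_indic R (measurable_tail t)).
rewrite expRD mulrA -ler_pdivrMr; last by rewrite expR_gt0.
rewrite -expRN opprK mulrC -ExZ //; apply: le_trans (mgf th0).
apply: Ex_le; [exact: integZ|exact/integ_bm/bexp|] => w.
rewrite indicE; case: (boolP (w \in _)) => [|_]; last by rewrite mulr0 expR_ge0.
by rewrite inE /tail_set /= mulr1 ler_expR => tY; rewrite ler_wpM2l.
Qed.

Lemma subgaussian_tail t : 0 <= t ->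
  (P [set w | (t <= Y w)%R] <= K%:E * expeR (- ((s * t ^+ 2)%:E / L%:E)))%E.
Proof.
move=> t0; rewrite (prob_Ex (measurable_tail t)).
have K0 : 0 < K by exact: lt_le_trans K1.
move: L0; rewrite le_eqVlt => /predU1P[L00|Lpos]; last first.
  rewrite inver gt_eqF //= lee_fin.
  (* This [th] minimizes the Chernoff exponent and brings it to [- s t^2 / L]. *)
  have th0 : 0 <= 2 * s * t / L.
    by apply: divr_ge0; [do 2!apply: mulr_ge0 => //; exact: ltW|exact: ltW].
  have := chernoff t th0; congr (_ <= _ * expR _).
  by field; rewrite !gt_eqF.
move: t0; rewrite le_eqVlt => /predU1P[<-|tpos].
  (* At [t = 0] the exponent is 0 even though [L = 0], and the bound is just [K >= 1]. *)
  rewrite expr0n /= mulr0 mul0e oppe0 /= expR0 mule1 lee_fin (le_trans _ K1) //.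
  rewrite -(Ex_cst P 1); apply: Ex_le.
  - exact/integ_bm/bm_indic/measurable_tail.
  - exact/integ_bm/bm_cst.
  - by move=> w; rewrite indicE; case: (_ \in _); rewrite ?lexx ?ler01.
have tail0 : Ex P (\1_(tail_set t)) <= 0.
  apply/ler_addgt0Pr => e e0; rewrite add0r.
  (* With [L = 0] the bound is [K * expR (- (th * t))] for every [th]; this choice suffices because
     [expR (K / e) >= 1 + K / e]. *)
  pose th := K / (e * t).
  have th0 : 0 <= th by apply: divr_ge0; [exact: ltW|apply: mulr_ge0; exact: ltW].
  apply: le_trans (chernoff t th0) _.
  rewrite -L00 mulr0 mul0r add0r expRN -ler_pdivlMl // -[leRHS]invrK.
  rewrite lef_pV2 ?posrE ?expR_gt0 ?invr_gt0 ?mulr_gt0 ?invr_gt0 //.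
  apply: le_trans (expR_ge1Dx _); rewrite invfM invrK.
  have -> : th * t = K * e^-1 by rewrite /th; field; rewrite !gt_eqF.
  by rewrite lerDr ler01.
(* The extended exponent is now minus infinity, so the right-hand side is 0. *)
rewrite -L00 inve0 gt0_muley ?lte_fin ?mulr_gt0 ?exprn_gt0 //= mule0 lee_fin.
exact: tail0.
Qed.

Lemma subgaussian_mean : ('E_P[Y] <= (Num.sqrt (L * ln K / s))%:E)%E.
Proof.
have iY := integ_bm P bY.
have -> : ('E_P[Y] = (Ex P Y)%:E)%E.
  by rewrite unlock /Ex /Rintegral fineK //; exact: integrable_fin_num.
rewrite lee_fin; set a := Ex P Y.
have K0 : 0 < K by exact: lt_le_trans K1.
have jensen th : 0 <= th -> th * a <= ln K + th ^+ 2 * L / (4 * s).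
  move=> th0; have h : expR (th * a) <= K * expR (th ^+ 2 * L / (4 * s)).
    apply: le_trans (mgf th0).
    (* Jensen's inequality by hand: [g] is the tangent to the exponential at the mean, and its
       expectation is the value there. *)
    pose g w := expR (th * a) * (1 - th * a) + expR (th * a) * th * Y w.
    have -> : expR (th * a) = Ex P g.
      rewrite ExD ?Ex_cst ?ExZ // -/a; first by ring.
        exact/integ_bm/bm_cst.
      exact: integZ.
    apply: Ex_le; [|exact/integ_bm/bexp|].
      by apply: integD; [exact/integ_bm/bm_cst|exact: integZ].
    move=> w; have -> : expR (th * Y w) = expR (th * a) * expR (th * Y w - th * a).
      by rewrite -expRD addrC subrK.
    have := ler_wpM2l (expR_ge0 (th * a)) (expR_ge1Dx (th * Y w - th * a)).
    by apply: le_trans; rewrite le_eqVlt; apply/orP; left; apply/eqP; rewrite /g; ring.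
  have := h; rewrite -ler_ln ?posrE ?expR_gt0 ?mulr_gt0 ?expR_gt0 //.
  by rewrite expRK lnM ?posrE ?expR_gt0 // expRK.
have [a0|a0] := leP a 0; first by rewrite (le_trans a0) // sqrtr_ge0.
have lnK : 0 <= ln K by rewrite ln_ge0.
rewrite -(ger0_norm (ltW a0)) -sqrtr_sqr ler_wsqrtr // ler_pdivlMr //.
move: L0; rewrite le_eqVlt => /predU1P[L00|Lpos].
  (* For [L = 0] a positive mean would satisfy [th * a <= ln K] for all [th]; this one makes
     [th * a] equal to [ln K + 1]. *)
  exfalso; have th0 : 0 <= (ln K + 1) / a 
    by apply: divr_ge0; [exact: addr_ge0|exact: ltW].
  have := jensen _ th0; rewrite -L00 mulr0 mul0r addr0 divfK ?gt_eqF //.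
  by rewrite leNgt ltrDl ltr01.
(* This maximizes [th * a - th^2 L / 4s] and leaves [s * a^2 <= L * ln K]. *)
have th0 : 0 <= 2 * s * a / L.
  have a0' := ltW a0; have s0' := ltW s0.
  by rewrite divr_ge0 ?(ltW Lpos) // !mulr_ge0.
have := jensen _ th0; rewrite -(ler_pM2r Lpos).
have -> : 2 * s * a / L * a * L = 2 * (s * a ^+ 2) by field; rewrite gt_eqF.
have -> : (ln K + (2 * s * a / L) ^+ 2 * L / (4 * s)) * L = L * ln K + s * a ^+ 2.
  by field; rewrite !gt_eqF.
by rewrite [a ^+ 2 * s]mulrC; lra.
Qed.

End subgaussian.

Lemma hermsym_expectation disp (W : measurableType disp) (R : realType)
    (P : probability W R) d (X : W -> 'M[R[i]]_d) :
  bounded_measurable_mx measurable X -> (forall w, X w \is hermsymmx) ->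
  expectation_mx P X \is hermsymmx.
Proof.
move=> bX hX; rewrite hermsymE; apply/eqP/matrixP => i j.
have hE w : X w i j = (X w j i)^*.
  by have := hX w; rewrite hermsymE => /eqP {1}->; rewrite !mxE.
rewrite !mxE; apply/eqP; rewrite eq_complex /=; apply/andP; split; apply/eqP.
  by under eq_fun do rewrite hE cRe_conjc.
have -> : (fun w => complex.Im (X w i j)) = (fun w => - complex.Im (X w j i)).
  by apply/funext => w; rewrite hE cIm_conjc.
have ExE f : fine 'E_P[f] = Ex P f by rewrite unlock.
rewrite !ExE; have := ExZ (P := P) (-1) (integ_bm P (bX j i).2).
by under eq_fun do rewrite mulN1r; rewrite mulN1r.
Qed.

(** * Self-reproducing functions *)

Section self_reproducing.
Context (R : realType) (disp : measure_display) (W : measurableType disp)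
  (P : probability W R) (n d : nat) (d0 : (0 < d)%N)
  (T : 'I_n -> topologicalType) (hT : forall k, polish R (T k))
  (z : W -> prod_topology T)
  (mz : measurable_wrt measurable (@borel (prod_topology T)) z)
  (z' : forall k : 'I_n, W -> T k)
  (mz' : forall k, measurable_wrt measurable (@borel (T k)) (z' k))
  (ciid : forall k, cond_iid P (sigma_except z k) (z' k) (fun w => z w k))
  (H : prod_topology T -> 'M[R[i]]_d)
  (hermH : forall x, H x \is hermsymmx)
  (bH : bounded_measurable_mx (@borel (prod_topology T)) H)
  (s : R) (s0 : 0 < s)
  (EH : 'I_n -> W -> 'M[R[i]]_d)
  (cEH : forall k, is_cond_exp_mx P (sigma_except z k) (H \o z) (EH k))
  (C : 'M[R[i]]_d) (hermC : C \is hermsymmx)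
  (self_reproducing : {ae P, forall w,
     \sum_(k < n) (H (z w) - EH k w) = (s%:C)%C *: (H (z w) - C)})
  (A : 'I_n -> 'M[R[i]]_d)
  (hermA : forall k, A k \is hermsymmx)
  (V : 'I_n -> W -> 'M[R[i]]_d)
  (cV : forall k, is_cond_exp_mx P (sigma_of z)
     (fun w => (H (z w) - H (resample z (z' k) w)) *m
               (H (z w) - H (resample z (z' k) w))) (V k))
  (VA : forall k, {ae P, forall w, loewner_le (V k w) (A k *m A k)}).

Let x0 : prod_topology T := z point.
Let sB : sigma_algebra setT (@borel (prod_topology T)).
Proof. exact: smallest_sigma_algebra. Qed.

Local Notation bS := (bounded_measurable_mx (@borel (prod_topology T))).

Let L := spectral_norm (\sum_(k < n) A k *m A k).
Let F th x := texp th (H x - C).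

Let hermHC x : H x - C \is hermsymmx.
Proof. exact: (hermsymB (hermH x) hermC). Qed.

Let bHC : bS (fun x => H x - C).
Proof. exact: (bmxD x0 sB bH (bmx_cst x0 sB (- C))). Qed.

Let bF th : 0 <= th -> bS (F th).
Proof. by move=> th0; exact: (bmx_texp x0 sB hermHC th0 bHC). Qed.

Let mzB : measurable_wrt measurable (<<s @borel_box n T >>) z.
Proof. by apply: measurable_boxes => j; exact: measurable_coord. Qed.

Let integ_hs_z (M N : prod_topology T -> 'M[R[i]]_d) : bS M -> bS N -> integ P (fun w => hs (M (z w)) (N (z w))).
Proof.
move=> bM bN; apply: integ_hsP; apply: integ_hs_bm; first exact: (bmx_comp hT).
by apply: bmx_integ; exact: (bmx_comp hT).
Qed.

Let integ_tr th : 0 <= th -> integ P (fun w => complex.Re (\tr (F th (z w)))).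
Proof.
move=> th0; have := integ_hs_z (bF th0) (bmx_cst x0 sB 1%:M).
by congr integ; apply/funext => w; rewrite /hs mulmx1.
Qed.

Let hermsum : \sum_(k < n) A k *m A k \is hermsymmx.
Proof.
rewrite hermsymE raddf_sum /= map_mx_sum; apply/eqP/eq_bigr => k _.
by have := hermA k; rewrite hermsymE trmx_mul map_mxM => /eqP <-.
Qed.

Lemma stein_bound th : 0 <= th ->
  s * Ex P (fun w => hs (H (z w) - C) (F th (z w))) <=
  th / 2 * (L * Ex P (fun w => complex.Re (\tr (F th (z w))))).
Proof.
move=> th0; have bFt := bF th0.
have iEH k : integ P (fun w => hs (EH k w) (F th (z w))).
  have := @integ_hsP _ W R P d (fun w => F th (z w)) (EH k).
  have -> : (fun w => hs (F th (z w)) (EH k w)) = (fun w => hs (EH k w) (F th (z w))).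
    by apply/funext => w; exact: hsC.
  apply; apply: integ_hs_bm; first exact: (bmx_comp hT).
  by move=> i j; have [[_ ? _ _] [_ ? _ _]] := cEH k i j.
have iH := integ_hs_z bH bFt; have iHC := integ_hs_z bHC bFt.
have iA k := integ_hs_z (bmx_cst x0 sB (A k *m A k)) bFt.
have iHE k := integB iH (iEH k).
rewrite -(ExZ _ iHC).
have -> : Ex P (fun w => s * hs (H (z w) - C) (F th (z w))) =
    Ex P (fun w => \sum_(k < n) (hs (H (z w)) (F th (z w)) - hs (EH k w) (F th (z w)))).
  apply: Ex_ae_eq; [exact: integZ|exact: integ_sum|].
  (* Self-reproduction splits [s] times the centred matrix into one difference per coordinate. *)
  apply: filterS self_reproducing => w sr.
  rewrite -hsZl -sr hs_suml; apply: eq_bigr => k _; exact: hsBl.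
rewrite Ex_sum //.
apply: (@le_trans _ _ (\sum_(k < n) th / 2 * Ex P (fun w => hs (A k *m A k) (F th (z w))))).
  apply: ler_sum => k _; rewrite (ExB iH (iEH k)).
  have mv x y : hs (H x - H y) (F th x - F th y) <=
      th / 2 * hs ((H x - H y) *m (H x - H y)) (F th x + F th y).
    have -> : H x - H y = (H x - C) - (H y - C).
      by rewrite opprB addrA subrK.
    exact: (mean_value_trace (hermHC x) (hermHC y) th0).
  have psd (Q : 'M[R[i]]_d) x : psdmx Q -> 0 <= hs Q (F th x).
    by move=> psdQ; apply: hs_psd_fmx => // u; exact: expR_ge0.
  have := coordinate_ineq hT mz (@mz' k) (@ciid k) bH bFt th0 mv psd (cEH k) (cV k) (VA k).
  exact.
(* The coordinates are summed before the norm is taken, so that the norm of the sum appears. *)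
rewrite -mulr_sumr; apply: ler_wpM2l; first by rewrite divr_ge0.
rewrite -Ex_sum // -ExZ; last exact: integ_tr.
apply: Ex_le; [exact: integ_sum|exact/integZ/integ_tr|] => w.
rewrite -hs_suml (_ : complex.Re _ = \sum_i expR (th * eigval (H (z w) - C) i)).
  by apply: hs_le_spectral_norm => // u; exact: expR_ge0.
exact: tr_fmx.
Qed.

Lemma trace_mgf_bound th : 0 <= th ->
  Ex P (fun w => complex.Re (\tr (F th (z w)))) <=
  d%:R * expR (th ^+ 2 * L / (4 * s)).
Proof.
move=> th0; pose m t := Ex P (fun w => complex.Re (\tr (F t (z w)))).
have L0 : 0 <= L by exact: spectral_norm_ge0.
(* Chosen so that [stein_bound] divided by [s] reads as growth at rate [c * t], which integrates to
   [th^2 L / 4s]. *)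
pose c := L / (2 * s); have c0 : 0 <= c by rewrite divr_ge0 // mulr_ge0 // ltW.
have m0 t : 0 <= m t.
  apply: Rintegral_ge0 => w _; rewrite (tr_fmx _ (H (z w) - C)).
  by apply: sumr_ge0 => i _; exact: expR_ge0.
have md : m 0 = d%:R.
  rewrite -[RHS](Ex_cst P); congr Ex; apply/funext => w.
  rewrite (tr_fmx _ (H (z w) - C)).
  by under eq_bigr do rewrite mul0r expR0; rewrite sumr_const card_ord.
have := @gronwall_backward R c m th c0 th0 m0.
rewrite md (_ : c * th ^+ 2 / 2 = th ^+ 2 * L / (4 * s)); last first.
  by rewrite /c; field; rewrite gt_eqF.
apply => t t' t'0 t't; have t0 : 0 <= t by exact: le_trans t't.
have iHC := integ_hs_z bHC (bF t0).
apply: (@le_trans _ _ ((t - t') * Ex P (fun w => hs (H (z w) - C) (F t (z w))))).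
  rewrite -ExZ // -ExB; [|exact: integ_tr|exact: integ_tr].
  apply: Ex_le; [by apply: integB; exact: integ_tr|exact: integZ|].
  by move=> w; exact: (tr_texp_diff t t' (hermHC (z w))).
apply: ler_wpM2l; first by rewrite subr_ge0.
have := stein_bound t0; rewrite -/(m t) => h.
rewrite -(ler_pM2l s0) (le_trans h) //.
have -> : s * (c * t * m t) = t / 2 * (L * m t); last exact: lexx.
by rewrite /c; field; rewrite gt_eqF.
Qed.

Lemma bm_lambda_max : @bounded_measurable R W measurable (fun w => lambda_max (H (z w) - C)).
Proof.
have [ml [K hK]] := bmf_lambda_max x0 sB d0 hermHC bHC.
by split; [move=> B mB; exact: mz _ (ml _ mB)|exists K => w; exact: hK].
Qed.

Lemma lambda_max_mgf_bound th : 0 <= th ->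
  Ex P (fun w => expR (th * lambda_max (H (z w) - C))) <=
  d%:R * expR (th ^+ 2 * L / (4 * s)).
Proof.
move=> th0; apply: le_trans (trace_mgf_bound th0).
apply: Ex_le; [exact/integ_bm/bm_expR/bm_lambda_max|exact: integ_tr|].
by move=> w; exact: expR_lambda_max_le.
Qed.

End self_reproducing.

Theorem corollary11p1 (R : realType) (disp : measure_display)
    (W : measurableType disp) (P : probability W R)
    (n d : nat) (hd : (0 < d)%N)
    (T : 'I_n -> topologicalType) (hT : forall k, polish R (T k))
    (z : W -> prod_topology T)
    (mz : measurable_wrt measurable (@borel (prod_topology T)) z)
    (z' : forall k : 'I_n, W -> T k)
    (mz' : forall k, measurable_wrt measurable (@borel (T k)) (z' k))
    (ciid : forall k, cond_iid P (sigma_except z k) (z' k) (fun w => z w k))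
    (H : prod_topology T -> 'M[R[i]]_d)
    (hermH : forall x, H x \is hermsymmx)
    (bndH : exists M : R, forall x, spectral_norm (H x) <= M)
    (mH : measurable_mx_wrt (@borel (prod_topology T)) H)
    (s : R) (hs : 0 < s)
    (EH : 'I_n -> W -> 'M[R[i]]_d)
    (hEH : forall k, is_cond_exp_mx P (sigma_except z k) (H \o z) (EH k))
    (self_reproducing : {ae P, forall w,
       \sum_(k < n) (H (z w) - EH k w) =
         (s%:C)%C *: (H (z w) - expectation_mx P (H \o z))})
    (A : 'I_n -> 'M[R[i]]_d)
    (hermA : forall k, A k \is hermsymmx)
    (V : 'I_n -> W -> 'M[R[i]]_d)
    (hV : forall k, is_cond_exp_mx P (sigma_of z)
       (fun w => let D := H (z w) - H (dfwith (z w) k (z' k w)) in D *m D) (V k))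
    (bounded_differences : forall k,
       {ae P, forall w, loewner_le (V k w) (A k *m A k)}) :
  let L := spectral_norm (\sum_(k < n) A k *m A k) in
  let X := fun w => lambda_max (H (z w) - expectation_mx P (H \o z)) in
  (* extended-real quotient: for L = 0 the exponent is 0 at t = 0, else -oo *)
  (forall t : R, 0 <= t ->
     (P [set w | (t <= X w)%R] <=
        d%:R%:E * expeR (- ((s * t ^+ 2)%:E / L%:E)))%E) /\
  ('E_P[X] <= (Num.sqrt (L * ln d%:R / s))%:E)%E.
Proof.
move=> L X.
have bH : bounded_measurable_mx (@borel (prod_topology T)) H.
  have [M hM] := bndH; move=> i j; have [mR mI] := mH i j.
  by split; split => //; exists M => x; have [h1 h2] := entry_le_spectral_norm (H x) i j;
    [exact: le_trans h1 (hM x)|exact: le_trans h2 (hM x)].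
have mzB : measurable_wrt measurable (<<s @borel_box n T >>) z.
  by apply: measurable_boxes => j; exact: measurable_coord.
have hermC : expectation_mx P (H \o z) \is hermsymmx.
  apply: hermsym_expectation => [|w]; last exact: hermH.
  exact: (bmx_comp hT mzB bH).
have bX := bm_lambda_max hd mz hermH bH hermC : bounded_measurable measurable X.
have d1 : 1 <= d%:R :> R by rewrite ler1n.
have L0 : 0 <= L by exact: spectral_norm_ge0.
have mgf th : 0 <= th -> Ex P (fun w => expR (th * X w)) <=
    d%:R * expR (th ^+ 2 * L / (4 * s)).
  exact: (lambda_max_mgf_bound hd hT mz mz' ciid hermH bH hs hEH hermC
    self_reproducing hermA hV bounded_differences).
split; first by move=> t t0; exact: (subgaussian_tail bX d1 hs L0 mgf t0).
exact: (subgaussian_mean bX d1 hs L0 mgf).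
Qed.
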